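(* Let $\theta\in[0,2\pi)$ and let $\xi$ denote the unitary extent. (i) The controlled-phase gate $C(\theta)=\mathrm{diag}(1,1,1,e^{i\theta})$, acting on any two qubits (not necessarily nearest neighbours), satisfies $\xi(C(\theta))=1+|\sin(\theta/2)|$, with optimal decomposition $$C(\theta)=e^{i\theta/4}\left(\cos\left(\tfrac\theta4\right)I+i\sin\left(\tfrac\theta4\right)Z\otimes Z\right)\left(R_Z\left(\tfrac\theta2\right)\otimes R_Z\left(\tfrac\theta2\right)\right).$$ (ii) The rotation $R_{ZZ}(\theta)=e^{-i\frac\theta2Z\otimes Z}$, acting on any two qubits, satisfies $\xi(R_{ZZ}(\theta))=1+|\sin\theta|$, with optimal decomposition $$R_{ZZ}(\theta)=\cos(\theta/2)\,I-i\sin(\theta/2)\,Z\otimes Z .$$ (iii) The $\mathrm{SWAP}$ gate acting on nearest-neighbour qubits satisfies $\xi(\mathrm{SWAP})=2$, with optimal decomposition $$\mathrm{SWAP}=\frac{e^{i\pi/4}}{\sqrt2}\,f\mathrm{SWAP}\,(I+iZ\otimes Z)\left(R_Z\left(\tfrac\pi2\right)\otimes R_Z\left(\tfrac\pi2\right)\right).$$ (iv) For every $t\in\mathbb{N}$, $\xi(C(\theta)^{\otimes t})=(1+|\sin(\theta/2)|)^t$, $\xi(R_{ZZ}(\theta)^{\otimes t})=(1+|\sin\theta|)^t$, and $\xi(\mathrm{SWAP}^{\otimes t})=2^t$ (each $\mathrm{SWAP}$ acting on nearest neighbours), and the $t$-fold tensor products of the decompositions in (i)–(iii) are optimal decomp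ositions.
   Context: On $n$ qubits let $c_{2j-1}=Z^{\otimes(j-1)}\otimes X\otimes I^{\otimes(n-j)}$ and $c_{2j}=Z^{\otimes(j-1)}\otimes Y\otimes I^{\otimes(n-j)}$, $j=1,\dots,n$. The set $G_n$ of Gaussian unitaries consists of the $n$-qubit unitaries $V$ for which there is $R\in O(2n)$ with $Vc_jV^\dagger=\sum_kR_{j,k}c_k$ for all $j$. The unitary extent of an $n$-qubit unitary $U$ is $\xi(U)=\min\{\|c\|_1^2: U=\sum_{j=1}^{\chi}c_jK_j,\ \chi\in\mathbb{N},\ K_j\in G_n,\ c_j\in\mathbb{C}\}$, where $\|c\|_1=\sum_j|c_j|$. A decomposition $U=\sum_jc_jK_j$ with $K_j\in G_n$ is optimal if $\xi(U)=\|c\|_1^2$. A two-qubit gate acting on qubits $j,k$ is regarded as an $n$-qubit unitary acting trivially on the other qubits. The displayed products are read as linear combinations of two Gaussian unitaries by expanding the bracketed sum. $R_Z(\theta)=e^{-i\theta Z/2}$. In the computational basis, $\mathrm{SWAP}$ exchanges $|01\rangle$ and $|10\rangle$ and fixes $|00\rangle,|11\rangle$; $f\mathrm{SWAP}$ exchanges $|01\rangle$ and $|10\rangle$, fixes $|00\rangle$, and maps $|11\rangle\mapsto-|11\rangle$. *)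

(* Defs.v *)
From mathcomp Require Import all_boot all_order all_algebra.
From mathcomp Require Import mxtens complex.
From mathcomp Require Import all_classical all_reals all_analysis.

Set Implicit Arguments.
Unset Strict Implicit.
Unset Printing Implicit Defensive.

Import Order.TTheory GRing.Theory Num.Theory.
Import numFieldNormedType.Exports.

Local Open Scope classical_set_scope.
Local Open Scope ring_scope.
Local Open Scope sesquilinear_scope.
Local Open Scope complex_scope.

(* Complex numbers are R[i] for a realType R.  The computational basis of n   *)
(* qubits is indexed by bit strings {ffun 'I_n -> 'I_2}, qubit i : 'I_n being *)
(* the (i+1)-st tensor factor; enum_val turns a matrix index into the bit     *)
(* string it stands for.  Nothing below depends on the order of this          *)
(* enumeration.                                                               *)
Definition qdim (n : nat) : nat := #|{ffun 'I_n -> 'I_2}|.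

Lemma qdimE (n : nat) : qdim n = (2 ^ n)%N.
Proof. by rewrite /qdim card_ffun !card_ord. Qed.

Definition bit (n : nat) (x : 'I_(qdim n)) (i : 'I_n) : 'I_2 :=
  (enum_val x : {ffun 'I_n -> 'I_2}) i.

Definition ket2 (a b : 'I_2) : 'I_(2 * 2) := mxtens_index (a, b).

Section Operators.
Context {R : realType}.
Local Notation C := R[i].

(* The notation 'i is ambiguous here (it may denote the imaginary unit of an   *)
(* abstract closed field), hence an explicit name.                            *)
Definition ii : C := 0 +i* 1.

(* e^{i phi} *)
Definition cis (phi : R) : C := cos phi +i* sin phi.

(* The matrix exponential, by its power series; the limit is taken entrywise  *)
(* on real and imaginary parts.                                               *)
Definition expmx_partial (m : nat) (A : 'M[C]_m) (N : nat) : 'M[C]_m :=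
  \sum_(k < N) (k`!%:R)^-1 *: A ^+ k.

Definition expmx (m : nat) (A : 'M[C]_m) : 'M[C]_m :=
  \matrix_(a, b)
    (limn (fun N => complex.Re (expmx_partial A N a b)) +i*
     limn (fun N => complex.Im (expmx_partial A N a b))).

Definition mx2 (a b c d : C) : 'M[C]_2 :=
  \matrix_(i, j) nth 0 (nth [::] [:: [:: a; b]; [:: c; d]] i) j.

Definition PX : 'M[C]_2 := mx2 0 1 1 0.
Definition PY : 'M[C]_2 := mx2 0 (- ii) ii 0.
Definition PZ : 'M[C]_2 := mx2 1 0 0 (-1).

Definition ZZ : 'M[C]_(2 * 2) := PZ *t PZ.

Definition RZ (phi : R) : 'M[C]_2 := expmx ((- ii * (phi / 2)%:C) *: PZ).

Definition RZZ (phi : R) : 'M[C]_(2 * 2) :=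
  expmx ((- ii * (phi / 2)%:C) *: ZZ).

Definition CPhase (phi : R) : 'M[C]_(2 * 2) :=
  diag_mx (\row_j nth 0 [:: 1; 1; 1; cis phi] j).

Definition SWAP : 'M[C]_(2 * 2) := tperm_mx (ket2 0 1) (ket2 1 0).

(* Column y is the image of the basis vector y. *)
Definition fSWAP : 'M[C]_(2 * 2) :=
  \matrix_(x, y) ((if y == ket2 1 1 then -1 else 1) * SWAP x y).

(* P 0 (x) ... (x) P (n-1) *)
Definition qubit_tensor (n : nat) (P : 'I_n -> 'M[C]_2) : 'M[C]_(qdim n) :=
  \matrix_(x, y) \prod_(i < n) P i (bit x i) (bit y i).

(* The tensor product of the two-qubit gates G s, where G s acts on qubits    *)
(* p s (first factor) and q s (second factor), and of the identity on all     *)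
(* other qubits.  It is meaningful when the pairs {p s, q s} are disjoint.    *)
Definition gate_tensor (T : finType) (n : nat) (p q : T -> 'I_n)
    (G : T -> 'M[C]_(2 * 2)) : 'M[C]_(qdim n) :=
  \matrix_(x, y)
    ((\prod_(s : T) G s (ket2 (bit x (p s)) (bit x (q s)))
                        (ket2 (bit y (p s)) (bit y (q s)))) *
     \prod_(i < n | [forall s, (i != p s) && (i != q s)])
        (bit x i == bit y i)%:R).

Definition gate_at (n : nat) (j k : 'I_n) (G : 'M[C]_(2 * 2)) :
    'M[C]_(qdim n) :=
  gate_tensor (fun _ : unit => j) (fun _ => k) (fun _ => G).

(* With 0-based indices, majorana (2i) and majorana (2i+1) carry X and Y,     *)
(* respectively, on qubit i, and Z on the qubits before it.                   *)
Definition majorana (n : nat) (m : 'I_(2 * n)) : 'M[C]_(qdim n) :=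
  qubit_tensor (fun i : 'I_n =>
    if (i < m./2)%N then PZ
    else if i == m./2 :> nat then (if odd m then PY else PX)
    else 1%:M).

Definition gaussian (n : nat) (V : 'M[C]_(qdim n)) : Prop :=
  V \is unitarymx /\
  exists O : 'M[R]_(2 * n), O *m O^T = 1%:M /\
    forall j : 'I_(2 * n),
      V *m majorana j *m V ^t* = \sum_k (O j k)%:C *: majorana k.

Definition l1norm (I : finType) (c : I -> C) : R :=
  \sum_i ComplexField.Normc.normc (c i).

Definition decomposition (n : nat) (I : finType) (c : I -> C)
    (K : I -> 'M[C]_(qdim n)) (U : 'M[C]_(qdim n)) : Prop :=
  (forall i, gaussian (K i)) /\ U = \sum_i c i *: K i.

Definition extent_values (n : nat) (U : 'M[C]_(qdim n)) : set R :=
  [set r | exists (chi : nat) (c : 'I_chi -> C) (K : 'I_chi -> 'M[C]_(qdim n)),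
     decomposition c K U /\ r = l1norm c ^+ 2].

(* The infimum is a minimum as soon as U has an optimal decomposition. *)
Definition xi (n : nat) (U : 'M[C]_(qdim n)) : R := inf (extent_values U).

Definition optimal (n : nat) (I : finType) (c : I -> C)
    (K : I -> 'M[C]_(qdim n)) (U : 'M[C]_(qdim n)) : Prop :=
  decomposition c K U /\ xi U = l1norm c ^+ 2.

(* The two terms of a displayed decomposition, obtained by expanding its      *)
(* bracketed sum, are indexed by bool: false for I and true for Z (x) Z.      *)
Definition two (T : Type) (a b : T) (e : bool) : T := if e then b else a.

Definition CPhase_coef (phi : R) : bool -> C :=
  two (cis (phi / 4) * (cos (phi / 4))%:C)
      (cis (phi / 4) * (ii * (sin (phi / 4))%:C)).

Definition CPhase_term (phi : R) (e : bool) : 'M[C]_(2 * 2) :=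
  two 1%:M ZZ e *m (RZ (phi / 2) *t RZ (phi / 2)).

Definition RZZ_coef (phi : R) : bool -> C :=
  two (cos (phi / 2))%:C (- ii * (sin (phi / 2))%:C).

Definition RZZ_term : bool -> 'M[C]_(2 * 2) := two 1%:M ZZ.

Definition SWAP_coef : bool -> C :=
  two (cis (pi / 4) / (Num.sqrt 2)%:C) (cis (pi / 4) / (Num.sqrt 2)%:C * ii).

Definition SWAP_term (e : bool) : 'M[C]_(2 * 2) :=
  fSWAP *m two 1%:M ZZ e *m (RZ (pi / 2) *t RZ (pi / 2)).

(* The t-fold tensor product of a decomposition has one term for each choice  *)
(* of a term in every factor.                                                 *)
Definition tensor_coef (t : nat) (c : bool -> C) (e : {ffun 'I_t -> bool}) :
    C := \prod_(s < t) c (e s).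

Definition tensor_term (t n : nat) (p q : 'I_t -> 'I_n)
    (K : bool -> 'M[C]_(2 * 2)) (e : {ffun 'I_t -> bool}) : 'M[C]_(qdim n) :=
  gate_tensor p q (fun s => K (e s)).

Definition tensor_power (t n : nat) (p q : 'I_t -> 'I_n)
    (G : 'M[C]_(2 * 2)) : 'M[C]_(qdim n) :=
  gate_tensor p q (fun _ => G).

End Operators.

Definition neighbours (n : nat) (j k : 'I_n) : Prop :=
  k = j.+1 :> nat \/ j = k.+1 :> nat.

Definition disjoint_pairs (t n : nat) (p q : 'I_t -> 'I_n) : Prop :=
  [/\ injective p, injective q & forall r s, p r != q s].

(* Main.v *)
Require Import Defs.
From mathcomp Require Import all_boot all_order all_algebra.
From mathcomp Require Import ring lra.
Import Order.TTheory GRing.Theory Num.Theory.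
Set Implicit Arguments.
Unset Strict Implicit.
Unset Printing Implicit Defensive.
Local Open Scope ring_scope.

(* Lower bounds come from duality: if |tr (W V)| / 2^n <= 1 for all Gaussian V,
   then |tr (W U)| / 2^n <= ||c||_1 for every decomposition of U.  Up to Gaussian
   factors, each gate is a tensor product of a + i b Z(x)Z, and the witness W is
   the tensor product of the 1 + w Z(x)Z with w = -i or i.  That W is admissible
   means that sum_S |kappa_S| <= 1, where kappa_S is the coefficient of a Gaussian
   V in front of the product of the Z(x)Z over S; such a product is, up to a
   phase, the Majorana monomial of a union of disjoint 4-element blocks.

   For one block B, let p_D be the total weight of the coefficients whose index
   set meets B in D.  The identity [sum_i c_i (x) c_i, V (x) V] = 0 makes V (x) V
   invariant under rotations mixing the two tensor factors; rotating by pi/4 on B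
   expresses the component (0, B) of V (x) V through the components (D, B \ D), and
   the triangle inequality gives sqrt(p_0) + sqrt(p_B) <= 1.  Restricting the
   coefficients to the index sets that meet B in 0 or in B preserves the quadratic
   relations, so induction on the number of blocks yields the claim.

   For the upper bounds, all terms are phases times products of unit vectors of
   the Clifford algebra: Z_j = -i c_0 c_1, the rotation about Z_j is
   (cos c_0 + sin c_1) c_0, and fSWAP = -i/2 (c_0 - c_2)(c_1 - c_3). *)

(** * Symmetric differences of index sets and sums over sets *)

Section SymmetricDifference.
Variable I : finType.
Implicit Types A B D : {set I}.

(** Index sets add modulo 2 when Majorana monomials are multiplied, because repeated generators
    cancel. *)
Definition symdiff A B : {set I} := [set i | (i \in A) (+) (i \in B)].
Local Notation "A :+: B" := (symdiff A B) (at level 52, left associativity).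

Lemma in_symdiff A B i : (i \in A :+: B) = (i \in A) (+) (i \in B).
Proof. by rewrite inE. Qed.

Lemma symdiffA A B D : A :+: (B :+: D) = A :+: B :+: D.
Proof. by apply/setP => i; rewrite !in_symdiff addbA. Qed.

Lemma symdiffC A B : A :+: B = B :+: A.
Proof. by apply/setP => i; rewrite !in_symdiff addbC. Qed.

Lemma symdiffAC A B D : A :+: B :+: D = A :+: D :+: B.
Proof. by rewrite -!symdiffA (symdiffC B). Qed.

Lemma symdiffK A B : A :+: B :+: B = A.
Proof. by apply/setP => i; rewrite !in_symdiff addbK. Qed.

Lemma symdiff_inj B : injective (fun A => A :+: B).
Proof. by apply: (can_inj (g := fun A => A :+: B)) => A; rewrite symdiffK. Qed.

Lemma sum_symdiff (V : nmodType) (P : pred {set I}) (F : {set I} -> V) D :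
  (forall A, P (A :+: D) = P A) ->
  \sum_(A | P A) F (A :+: D) = \sum_(A | P A) F A.
Proof.
move=> PD; rewrite [RHS](reindex_inj (@symdiff_inj D)).
by apply: eq_bigl => A; rewrite PD.
Qed.

Lemma disjoint_setU1 A B i :
  [disjoint A & i |: B] = (i \notin A) && [disjoint A & B].
Proof. by rewrite !disjoints_subset setCU subsetI -disjoints_subset disjoint_sym disjoints1. Qed.

Lemma disjoint_toggle A B i :
  i \notin B -> [disjoint A :+: [set i] & B] = [disjoint A & B].
Proof.
move=> iB; rewrite -!setI_eq0; congr (_ == set0); apply/setP => k; rewrite !inE.
by case: (eqVneq k i) => [->|_]; rewrite ?(negbTE iB) ?andbF // addbF.
Qed.

(** The sets containing [i] are reached from those avoiding it by toggling [i]. Iterating this sorts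
    all sets by their intersection with a block. *)
Lemma sum_toggle (V : nmodType) (F : {set I} -> V) (B : {set I}) i :
  i \notin B ->
  \sum_(A : {set I} | [disjoint A & B]) F A =
  \sum_(A : {set I} | [disjoint A & i |: B]) F A
  + \sum_(A : {set I} | [disjoint A & i |: B]) F (A :+: [set i]).
Proof.
move=> iB; rewrite (bigID (fun A : {set I} => i \notin A)) /=; congr (_ + _).
  by apply: eq_bigl => A; rewrite disjoint_setU1 andbC.
rewrite [LHS](reindex_inj (@symdiff_inj [set i])).
apply: eq_bigl => A; rewrite disjoint_setU1 disjoint_toggle //.
by rewrite in_symdiff inE eqxx addbT negbK andbC.
Qed.
End SymmetricDifference.
Notation "A :+: B" := (symdiff A B) (at level 52, left associativity).

(** * Squared norms, inner products and a spin rotation *)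

Section SumNorm.
Variable C : numClosedFieldType.
Variables (X : finType) (ok : pred X).
Implicit Types u v : X -> C.

Definition sqnorm u : C := \sum_(x | ok x) `|u x| ^+ 2.

Lemma sqnorm_ge0 u : 0 <= sqnorm u.
Proof. by apply: sumr_ge0 => x _; rewrite exprn_ge0. Qed.

Lemma sqnorm0_eq0 u x : sqnorm u = 0 -> ok x -> u x = 0.
Proof.
move=> /eqP u0 okx; move: u0.
rewrite psumr_eq0 => [/allP/(_ x)|y _]; last by rewrite exprn_ge0.
by rewrite mem_index_enum okx /= sqrf_eq0 normr_eq0 => /(_ isT)/eqP.
Qed.

(* Convexity of the square: |u + v|^2 <= (a + b) (|u|^2 / a + |v|^2 / b). *)
Lemma sqnorm_triangle u v (a b : C) :
  0 <= a -> 0 <= b -> sqnorm u <= a ^+ 2 -> sqnorm v <= b ^+ 2 ->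
  sqnorm (fun x => u x + v x) <= (a + b) ^+ 2.
Proof.
rewrite le0r => /predU1P[->|a_gt0].
  move=> b0; rewrite expr0n /= add0r => u0; apply: le_trans.
  have {}u0 : sqnorm u = 0 by apply/eqP; rewrite eq_le u0 sqnorm_ge0.
  by rewrite le_eqVlt /sqnorm (eq_bigr (fun x => `|v x| ^+ 2)) ?eqxx // => x okx;
    rewrite (sqnorm0_eq0 u0) ?add0r.
rewrite le0r => /predU1P[->|b_gt0].
  move=> u0; rewrite expr0n /= addr0 => v0; apply: le_trans u0.
  have {}v0 : sqnorm v = 0 by apply/eqP; rewrite eq_le v0 sqnorm_ge0.
  by rewrite le_eqVlt /sqnorm (eq_bigr (fun x => `|u x| ^+ 2)) ?eqxx // => x okx;
    rewrite (sqnorm0_eq0 v0) ?addr0.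
move=> ua vb.
apply: (@le_trans _ _ ((a + b) * (sqnorm u / a + sqnorm v / b))); last first.
  rewrite expr2; apply: ler_wpM2l; first by rewrite addr_ge0 ?ltW.
  by apply: lerD; rewrite ler_pdivrMr // -expr2.
rewrite mulrDr !mulr_suml !mulr_sumr -big_split /=; apply: ler_sum => x _.
apply: (@le_trans _ _ ((`|u x| + `|v x|) ^+ 2)).
  by apply: lerXn2r (ler_normD _ _); rewrite nnegrE ?addr_ge0 ?normr_ge0.
rewrite -subr_ge0.
have -> : (a + b) * (`|u x| ^+ 2 / a) + (a + b) * (`|v x| ^+ 2 / b)
   - (`|u x| + `|v x|) ^+ 2 = (b * `|u x| - a * `|v x|) ^+ 2 / (a * b).
  by field; rewrite !gt_eqF.
apply: divr_ge0; last by rewrite mulr_ge0 ?ltW.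
by rewrite real_exprn_even_ge0 // rpredB // ger0_real // mulr_ge0 // ltW.
Qed.

(** Minkowski's inequality, with bounds [a j] in place of the norms; induction on
    [sqnorm_triangle]. *)
Lemma sqnorm_sum (J : Type) (s : seq J) (u : J -> X -> C) (a : J -> C) :
  (forall j, 0 <= a j) -> (forall j, sqnorm (u j) <= a j ^+ 2) ->
  sqnorm (fun x => \sum_(j <- s) u j x) <= (\sum_(j <- s) a j) ^+ 2.
Proof.
move=> a0 ua; elim: s => [|j s IH].
  rewrite big_nil expr0n /= /sqnorm big1 // => x _.
  by rewrite big_nil normr0 expr0n.
rewrite big_cons; apply: le_trans (sqnorm_triangle _ _ (ua j) IH) => //; last exact: sumr_ge0.
by rewrite le_eqVlt; apply/orP; left; apply/eqP/eq_bigr => x _; rewrite big_cons.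
Qed.

Definition inner u v : C := \sum_(x | ok x) u x * (v x)^*.

Lemma innerDl u v w : inner (fun x => u x + v x) w = inner u w + inner v w.
Proof. by rewrite -big_split; apply: eq_bigr => x _; rewrite mulrDl. Qed.
Lemma innerDr u v w : inner w (fun x => u x + v x) = inner w u + inner w v.
Proof. by rewrite -big_split; apply: eq_bigr => x _; rewrite rmorphD mulrDr. Qed.
Lemma innerZl a u w : inner (fun x => a * u x) w = a * inner u w.
Proof. by rewrite mulr_sumr; apply: eq_bigr => x _; rewrite mulrA. Qed.
Lemma innerZr a u w : inner w (fun x => a * u x) = a^* * inner w u.
Proof. by rewrite mulr_sumr; apply: eq_bigr => x _; rewrite rmorphM mulrCA. Qed.
Lemma sqnormE u : sqnorm u = inner u u.
Proof. by apply: eq_bigr => x _; rewrite normCK. Qed.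
Lemma eq_inner u u' v v' :
  (forall x, ok x -> u x = u' x) -> (forall x, ok x -> v x = v' x) ->
  inner u v = inner u' v'.
Proof. by move=> uu' vv'; apply: eq_bigr => x okx; rewrite uu' // vv'. Qed.
Lemma innerNl u w : inner (fun x => - u x) w = - inner u w.
Proof. by rewrite -sumrN; apply: eq_bigr => x _; rewrite mulNr. Qed.
Lemma innerNr u w : inner w (fun x => - u x) = - inner w u.
Proof. by rewrite -sumrN; apply: eq_bigr => x _; rewrite rmorphN mulrN. Qed.

Lemma sqnormDi u v :
  sqnorm (fun x => u x + 'i * v x) =
  inner u u + inner v v + 'i * (inner v u - inner u v).
Proof.
have iNi d : 'i * (- 'i * d) = d :> C by rewrite mulrA mulrN -expr2 sqrCi opprK mul1r.
by rewrite sqnormE innerDl !innerDr !innerZl !innerZr conjCi iNi; ring.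
Qed.

(* The tridiagonal matrix is that of twice the spin operator S_x on the       *)
(* symmetric subspace of four spins 1/2, and the conclusion says that         *)
(* e^{i (pi/2) S_x} is unitary.                                               *)
Lemma spin_rotation (R : (X -> C) -> X -> C) (Y0 Y1 Y2 Y3 Y4 : X -> C) :
  (forall u v, inner (R u) v = inner u (R v)) ->
  (forall x, ok x -> R Y0 x = - Y1 x) ->
  (forall x, ok x -> R Y1 x = - (4%:R * Y0 x + 2%:R * Y2 x)) ->
  (forall x, ok x -> R Y2 x = - (3%:R * Y1 x + 3%:R * Y3 x)) ->
  (forall x, ok x -> R Y3 x = - (2%:R * Y2 x + 4%:R * Y4 x)) ->
  (forall x, ok x -> R Y4 x = - Y3 x) ->
  sqnorm (fun x => (Y0 x - Y2 x + Y4 x) + 'i * (Y1 x - Y3 x)) = 16%:R * sqnorm Y0.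
Proof.
move=> Rsym R0 R1 R2 R3 R4.
(* Substituting the tridiagonal form into these instances of the symmetry of [R] gives linear
   relations between the inner products of the Y_j. *)
have e00 := Rsym Y0 Y0; have e01 := Rsym Y0 Y1; have e02 := Rsym Y0 Y2.
have e03 := Rsym Y0 Y3; have e04 := Rsym Y0 Y4.
have e10 := Rsym Y1 Y0; have e20 := Rsym Y2 Y0.
have e30 := Rsym Y3 Y0; have e40 := Rsym Y4 Y0.
have e11 := Rsym Y1 Y1; have e22 := Rsym Y2 Y2; have e33 := Rsym Y3 Y3.
have e12 := Rsym Y1 Y2; have e13 := Rsym Y1 Y3; have e14 := Rsym Y1 Y4.
have e21 := Rsym Y2 Y1; have e31 := Rsym Y3 Y1; have e41 := Rsym Y4 Y1.
have e23 := Rsym Y2 Y3; have e24 := Rsym Y2 Y4; have e34 := Rsym Y3 Y4.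
have e32 := Rsym Y3 Y2; have e42 := Rsym Y4 Y2; have e43 := Rsym Y4 Y3.
have rr u v w : (forall x, ok x -> u x = v x) -> inner u w = inner v w.
  by move=> uv; apply: eq_inner.
have rl u v w : (forall x, ok x -> u x = v x) -> inner w u = inner w v.
  by move=> uv; apply: eq_inner.
rewrite ?(rr _ _ _ R0) ?(rr _ _ _ R1) ?(rr _ _ _ R2) ?(rr _ _ _ R3) ?(rr _ _ _ R4)
  ?(rl _ _ _ R0) ?(rl _ _ _ R1) ?(rl _ _ _ R2) ?(rl _ _ _ R3) ?(rl _ _ _ R4)
  ?(innerNl, innerNr, innerDl, innerDr, innerZl, innerZr, rmorph_nat)
  in e00 e11 e22 e33 e01 e02 e03 e04 e10 e20 e30 e40
     e12 e13 e14 e21 e31 e41 e23 e24 e34 e32 e42 e43.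
have -> : sqnorm (fun x => (Y0 x - Y2 x + Y4 x) + 'i * (Y1 x - Y3 x)) =
  inner (fun x => Y0 x - Y2 x + Y4 x) (fun x => Y0 x - Y2 x + Y4 x)
  + inner (fun x => Y1 x - Y3 x) (fun x => Y1 x - Y3 x)
  + 'i * (inner (fun x => Y1 x - Y3 x) (fun x => Y0 x - Y2 x + Y4 x)
    - inner (fun x => Y0 x - Y2 x + Y4 x) (fun x => Y1 x - Y3 x)).
  exact: sqnormDi.
rewrite !sqnormE !(innerNl, innerNr, innerDl, innerDr).
(* Linear combination of the relations <R Y_j, Y_k> = <Y_j, R Y_k>. *)
have lc k a b (e : a = b :> C) (z : C) : z + k * (a - b) = z by rewrite e subrr mulr0 addr0.
apply/eqP; rewrite -subr_eq0; apply/eqP.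
rewrite -[RHS](lc (- 2) _ _ e01) -[RHS](lc (2 / 3) _ _ e03).
rewrite -[RHS](lc (7 / 4) _ _ e10) -[RHS](lc (- (5 / 12)) _ _ e12).
rewrite -[RHS](lc (5 / 12) _ _ e14) -[RHS](lc (1 / 2) _ _ e21).
rewrite -[RHS](lc (- (1 / 6)) _ _ e23) -[RHS](lc (- (1 / 4)) _ _ e30).
rewrite -[RHS](lc (1 / 4) _ _ e32) -[RHS](lc (- (1 / 4)) _ _ e34).
rewrite -[RHS](lc (- (20 / 3) * 'i) _ _ e00) -[RHS](lc ((2 / 3) * 'i) _ _ e02).
rewrite -[RHS](lc (- (11 / 12) * 'i) _ _ e11) -[RHS](lc ((1 / 4) * 'i) _ _ e13).
rewrite -[RHS](lc ((2 / 3) * 'i) _ _ e20) -[RHS](lc (- (1 / 3) * 'i) _ _ e22).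
rewrite -[RHS](lc ((1 / 4) * 'i) _ _ e31) -[RHS](lc (- (1 / 4) * 'i) _ _ e33).
by field.
Qed.
End SumNorm.

(** * Quadratic relations *)

Section Pluecker.
Variables (C : numClosedFieldType) (N : nat).
Local Notation I := 'I_N.
Implicit Types (A B D E : {set I}) (kappa : {set I} -> C).

(** The Jordan-Wigner sign: c_i passes the generators of smaller index on its way to its place in
    the ordered monomial of [E]. *)
Definition jw_sign (i : I) (E : {set I}) : C :=
  \prod_(k in E | (k < i)%N) -1.

Lemma jw_signK i E : jw_sign i E * jw_sign i E = 1.
Proof. by rewrite -big_split big1 //= => k _; rewrite mulrNN mulr1. Qed.

Lemma norm_jw_sign i E : `|jw_sign i E| = 1.
Proof. by rewrite normr_prod big1 // => k _; rewrite normrN1. Qed.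

Lemma jw_sign_real i E : (jw_sign i E)^* = jw_sign i E.
Proof. by rewrite rmorph_prod; apply: eq_bigr => k _; rewrite rmorphN1. Qed.

(* The coefficients [kappa] of K in the Majorana monomials satisfy this when   *)
(* K (x) K commutes with sum_i c_i (x) c_i.                                   *)
Definition pluecker kappa :=
  forall A E, \sum_(i in E)
    jw_sign i E * (kappa (A :+: [set i]) * kappa (A :+: E :+: [set i])) = 0.

Definition restrict B D kappa A : C := if A :&: B == D then kappa A else 0.

(** The two index sets in each product differ by [E]. If [E] meets [B], they meet [B] differently
    and every term dies; otherwise toggling an element of [E] does not affect the intersection with
    [B], so the terms survive or vanish together. *)
Lemma pluecker_restrict B D kappa :
  pluecker kappa -> pluecker (restrict B D kappa).
Proof.
move=> pk A E; have [EB|EB] := boolP [disjoint E & B]; last first.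
  rewrite big1 // => i iE; rewrite /restrict.
  case: eqP => [AD|_]; last by rewrite mul0r mulr0.
  case: eqP => [AED|_]; last by rewrite mulr0 mulr0.
  case/negP: EB; rewrite -setI_eq0; apply/eqP/setP => k; rewrite !inE.
  move: AED; rewrite -AD => /setP/(_ k); rewrite !inE.
  by case: (k \in E) (k \in B) (k \in A) (k == i) => [] [] [] [].
case: (boolP (A :&: B == D)) => AD; last first.
  rewrite big1 // => i iE; rewrite /restrict ifN ?mul0r ?mulr0 //.
  apply: contraNN AD => /eqP<-; apply/eqP/setP => k; rewrite !inE.
  case: (eqVneq k i) => [->|_]; last by rewrite addbF.
  by rewrite (disjointFr EB iE) !andbF.
rewrite -[RHS](pk A E); apply: eq_bigr => i iE; congr (_ * _).
rewrite /restrict !ifT //.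
  apply/eqP; rewrite -(eqP AD); apply/setP => k; rewrite !inE.
  case: (boolP (k \in B)) => kB; rewrite ?andbF ?andbT //.
  rewrite (disjointFl EB kB) addbF; case: (eqVneq k i) => [ki|_]; last by rewrite addbF.
  by move: kB; rewrite ki (disjointFr EB iE).
apply/eqP; rewrite -(eqP AD); apply/setP => k; rewrite !inE.
case: (eqVneq k i) => [->|_]; last by rewrite addbF.
by rewrite (disjointFr EB iE) !andbF.
Qed.

(* [jw_sign i E] depends on [E] only, so that it can be absorbed in the       *)
(* products [kappa A * kappa (A :+: E)].                                      *)
Definition gauge E A : C := \prod_(k in A) jw_sign k E.

Lemma gauge_toggle E A i : gauge E (A :+: [set i]) = jw_sign i E * gauge E A.
Proof.
rewrite /gauge; case: (boolP (i \in A)) => iA.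
  rewrite [in RHS](bigD1 i) //= mulrA jw_signK mul1r; apply: eq_bigl => k.
  by rewrite !inE; case: (eqVneq k i) => [->|_]; rewrite ?iA // addbF andbT.
rewrite (bigD1 i) /=; last by rewrite !inE eqxx addbT.
congr (_ * _); apply: eq_bigl => k.
by rewrite !inE; case: (eqVneq k i) => [->|_]; rewrite ?(negbTE iA) // addbF andbT.
Qed.

Lemma norm_gauge E A : `|gauge E A| = 1.
Proof. by rewrite normr_prod big1 // => k _; rewrite norm_jw_sign. Qed.

(** Up to the gauge sign, the component of V (x) V on the monomials of [A] and [A :+: E]. *)
Definition pair_prod kappa E A : C := gauge E A * (kappa A * kappa (A :+: E)).

Lemma pair_prod_sum kappa E A : pluecker kappa ->
  \sum_(i in E) pair_prod kappa E (A :+: [set i]) = 0.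
Proof.
move=> pk; rewrite -[RHS](mulr0 (gauge E A)) -[in RHS](pk A E) mulr_sumr.
apply: eq_bigr => i _; rewrite /pair_prod gauge_toggle mulrCA !mulrA.
by rewrite (symdiffAC A [set i]); ring.
Qed.

Variables b0 b1 b2 b3 : I.
Hypothesis b_uniq : uniq [:: b0; b1; b2; b3].
Local Notation B := [set b0; b1; b2; b3].

Definition toggle (b : bool) (i : I) A := if b then A :+: [set i] else A.

Lemma toggleN b i A : toggle (~~ b) i A = toggle b i A :+: [set i].
Proof. by case: b => //=; rewrite symdiffK. Qed.
Lemma toggleAC b i A j : toggle b i (A :+: [set j]) = toggle b i A :+: [set j].
Proof. by case: b => //=; rewrite symdiffAC. Qed.

(** The four bits encode a subset D of the block, which is added to [A] modulo 2. *)
Definition fourtuple a b c d A := toggle a b0 (toggle b b1 (toggle c b2 (toggle d b3 A))).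

Lemma in_fourtuple a b c d A i : (i \in fourtuple a b c d A) =
  (i \in A) (+) (a && (i == b0)) (+) (b && (i == b1)) (+) (c && (i == b2)) (+) (d && (i == b3)).
Proof.
rewrite /fourtuple; case: a b c d => [] [] [] [] /=; rewrite ?inE ?addbF //;
by move: (i \in A) (i == b0) (i == b1) (i == b2) (i == b3) => [] [] [] [] [].
Qed.

Lemma mem_four i : (i \in B) = (i == b0) (+) (i == b1) (+) (i == b2) (+) (i == b3).
Proof.
move: b_uniq; rewrite /= !inE !negb_or => /and4P[/and3P[n01 n02 n03] /andP[n12 n13] n23 _].
have [->|_] := eqVneq i b0; first by rewrite (negbTE n01) (negbTE n02) (negbTE n03).
have [->|_] := eqVneq i b1; first by rewrite (negbTE n12) (negbTE n13).
by have [->|_] := eqVneq i b2; first by rewrite (negbTE n23).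
Qed.

Lemma symdiff_four A : A :+: [set b0] :+: [set b1] :+: [set b2] :+: [set b3] = A :+: B.
Proof.
apply/setP => i; rewrite !in_symdiff mem_four !in_set1.
by rewrite !addbA.
Qed.

(** In a pair (r, E), r is the part outside the block of the first index set and E is the difference
    of the two index sets. That E contains the block means that the two index sets cut the block in
    complementary subsets D and B \ D. *)
Definition admissible (x : {set I} * {set I}) := [disjoint x.1 & B] && (B \subset x.2).

Variable kappa : {set I} -> C.
Hypothesis kappaP : pluecker kappa.

Definition yvec a b c d (x : {set I} * {set I}) : C :=
  pair_prod kappa x.2 (fourtuple a b c d x.1).

(* On a product of Fock space vectors, this is the part outside B of the      *)
(* operator sum_i (a_i (x) a_i^* + a_i^* (x) a_i), with its signs gauged away. *)
Definition hop (u : {set I} * {set I} -> C) x : C :=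
  \sum_(i in x.2 :\: B) u (x.1 :+: [set i], x.2).

Lemma sum_admissible (f : {set I} * {set I} -> C) :
  \sum_(x | admissible x) f x =
  \sum_(E : {set I} | B \subset E) \sum_(r : {set I} | [disjoint r & B]) f (r, E).
Proof. by rewrite exchange_big pair_big_dep; apply: eq_bigr => -[]. Qed.

(** Toggling an element outside the block is an involution that preserves admissibility, so [hop] is
    a symmetric 0-1 matrix. *)
Lemma hop_sym u v : inner admissible (hop u) v = inner admissible u (hop v).
Proof.
rewrite /inner !sum_admissible; apply: eq_bigr => D BD.
rewrite /hop /=; under eq_bigr do rewrite mulr_suml.
under [RHS]eq_bigr do rewrite rmorph_sum mulr_sumr.
rewrite exchange_big [RHS]exchange_big /=; apply: eq_bigr => i; rewrite inE => /andP[iB _].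
rewrite -[LHS](sum_symdiff _ (D := [set i])).
  by apply: eq_bigr => r _; rewrite symdiffK.
by move=> A; apply: disjoint_toggle.
Qed.

(** The quadratic relation for [E], split at the block: the elements outside it give [hop], and each
    of the four elements in it flips one bit. *)
Lemma hop_yvec a b c d x : admissible x ->
  hop (yvec a b c d) x = - (yvec (~~ a) b c d x + yvec a (~~ b) c d x
    + yvec a b (~~ c) d x + yvec a b c (~~ d) x).
Proof.
case: x => r E /andP[/= _ BE].
have := pair_prod_sum E (fourtuple a b c d r) kappaP.
rewrite (bigID (fun i => i \in B)) /= => /eqP; rewrite addr_eq0 => /eqP.
have -> : \sum_(i in E | i \in B) pair_prod kappa E (fourtuple a b c d r :+: [set i]) =
  yvec (~~ a) b c d (r, E) + yvec a (~~ b) c d (r, E)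
    + yvec a b (~~ c) d (r, E) + yvec a b c (~~ d) (r, E).
  rewrite (eq_bigl (mem [:: b0; b1; b2; b3])); last first.
    move=> i; rewrite -topredE /= !inE -!orbA andb_idl // => iB.
    by apply: (subsetP BE); rewrite !inE -!orbA.
  rewrite -big_uniq //= !big_cons big_nil addr0 !addrA.
  by rewrite /yvec /fourtuple !toggleN !toggleAC.
move=> ->; rewrite opprK /hop; apply: eq_big => [i|i _].
  by rewrite inE andbC.
by rewrite /yvec /fourtuple /= !toggleAC.
Qed.

Definition weight a b c d : C :=
  \sum_(r : {set I} | [disjoint r & B]) `|kappa (fourtuple a b c d r)| ^+ 2.

Lemma weight_ge0 a b c d : 0 <= weight a b c d.
Proof. by apply: sumr_ge0 => r _; rewrite exprn_ge0. Qed.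

(** The part of the second index set outside the block is [E :+: r :+: B], and it ranges freely over
    the sets disjoint from the block. With this set as summation variable the double sum
    factorises. *)
Lemma sqnorm_yvec a b c d :
  sqnorm admissible (yvec a b c d) =
  weight a b c d * weight (~~ a) (~~ b) (~~ c) (~~ d).
Proof.
rewrite /sqnorm sum_admissible exchange_big mulr_suml; apply: eq_bigr => r rB.
rewrite mulr_sumr (reindex_inj (@symdiff_inj _ (r :+: B))) /=.
apply: eq_big => [s|s _].
  rewrite disjoint_sym disjoints_subset.
  apply/subsetP/subsetP => sB i iB; have := sB i iB;
   rewrite /symdiff !(in_set, in_setC) (disjointFl rB iB) ?addFb; move: iB; rewrite !in_set => ->;
   by case: (i \in s).
rewrite /yvec /pair_prod normrM norm_gauge mul1r normrM exprMn /=; congr (_ * `|kappa _| ^+ 2).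
apply/setP => i; rewrite !(in_symdiff, in_fourtuple) mem_four.
by move: (i \in s) (i \in r) (i == b0) (i == b1) (i == b2) (i == b3) a b c d
  => [] [] [] [] [] [] [] [] [] [].
Qed.

Lemma weight_sum :
  \sum_(A : {set I}) `|kappa A| ^+ 2 =
  \sum_(a : bool) \sum_(b : bool) \sum_(c : bool) \sum_(d : bool) weight a b c d.
Proof.
have -> : \sum_(A : {set I}) `|kappa A| ^+ 2 =
    \sum_(A : {set I} | [disjoint A & set0]) `|kappa A| ^+ 2.
  by apply: eq_bigl => A; rewrite disjoints_subset setC0 subsetT.
move: b_uniq; rewrite /= !inE !negb_or => /and4P[/and3P[n01 n02 n03] /andP[n12 n13] n23 _].
have B4 : b3 |: (b2 |: (b1 |: (b0 |: set0))) = B.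
  by apply/setP => i; rewrite !inE; move: (i == b0) (i == b1) (i == b2) (i == b3) => [] [] [] [].
rewrite (sum_toggle _ (i := b0)) ?inE //.
rewrite !(sum_toggle _ (i := b1) (B := b0 |: set0)) ?inE ?negb_or ?(eq_sym b1) ?n01 //.
rewrite !(sum_toggle _ (i := b2) (B := b1 |: _)) ?inE ?negb_or ?(eq_sym b2) ?n02 ?n12 //.
rewrite !(sum_toggle _ (i := b3) (B := b2 |: _)) ?inE ?negb_or ?(eq_sym b3) ?n03 ?n13 ?n23 //.
rewrite B4 !big_bool /weight /fourtuple /=.
by ring.
Qed.

Let quads : seq (bool * bool * bool * bool) :=
  let bb := [:: false; true] in
  [seq (x.1, x.2, y.1, y.2) | x <- [seq (a, b) | a <- bb, b <- bb],
                              y <- [seq (c, d) | c <- bb, d <- bb]].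

(** The component with empty D has norm sqrt(p_0 p_B). By [spin_rotation] the phased sum of all
    sixteen components has four times that norm, as a rotation by pi/4 on four spins has entries of
    modulus 1/4; Minkowski's inequality bounds it by the sum of the sixteen norms. *)
Lemma weight_rotation :
  4%:R * (sqrtC (weight false false false false) * sqrtC (weight true true true true))
  <= \sum_(a : bool) \sum_(b : bool) \sum_(c : bool) \sum_(d : bool)
     sqrtC (weight a b c d) * sqrtC (weight (~~ a) (~~ b) (~~ c) (~~ d)).
Proof.
pose s a b c d := sqrtC (weight a b c d).
have s_ge0 a b c d : 0 <= s a b c d by rewrite sqrtC_ge0 weight_ge0.
pose y := yvec; pose T := true; pose F := false.
(* [Y1], [Y2] and [Y3] collect the components with one, two and three block elements in the first
   factor; on these sums [hop] acts by the tridiagonal matrix of [spin_rotation]. *)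
pose Y1 x := y T F F F x + y F T F F x + y F F T F x + y F F F T x.
pose Y2 x := y T T F F x + y T F T F x + y T F F T x + y F T T F x + y F T F T x + y F F T T x.
pose Y3 x := y F T T T x + y T F T T x + y T T F T x + y T T T F x.
have hopD u v x : hop (fun x => u x + v x) x = hop u x + hop v x.
  by rewrite /hop -big_split.
have e16 : sqnorm admissible (fun x => (y F F F F x - Y2 x + y T T T T x) + 'i * (Y1 x - Y3 x))
    = 16%:R * sqnorm admissible (y F F F F).
  apply: (spin_rotation hop_sym) => x admx.
  - by rewrite hop_yvec.
  - by rewrite /Y1 /Y2 !hopD !hop_yvec //= -/y /T /F; ring.
  - by rewrite /Y1 /Y2 /Y3 !hopD !hop_yvec //= -/y /T /F; ring.
  - by rewrite /Y2 /Y3 !hopD !hop_yvec //= -/y /T /F; ring.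
  - by rewrite /Y3 hop_yvec //= -/y /T /F; ring.
(* In the rotated vector each component carries the phase i to the number of block elements in the
   first factor; [n] holds the norms of the components. *)
pose n (j : bool * bool * bool * bool) := let: (a, b, c, d) := j in
  s a b c d * s (~~ a) (~~ b) (~~ c) (~~ d).
pose u (j : bool * bool * bool * bool) x := let: (a, b, c, d) := j in
  'i ^+ (a + b + c + d) * y a b c d x.
have n_ge0 j : 0 <= n j by case: j => [[[a b] c] d]; rewrite mulr_ge0.
have un j : sqnorm admissible (u j) <= n j ^+ 2.
  case: j => [[[a b] c] d]; rewrite le_eqVlt; apply/orP; left; apply/eqP.
  rewrite exprMn !sqrtCK -sqnorm_yvec; apply: eq_bigr => x _.
  by rewrite normrM normrX normCi expr1n mul1r.
have := sqnorm_sum quads n_ge0 un.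
have -> : sqnorm admissible (fun x => \sum_(j <- quads) u j x) =
  sqnorm admissible (fun x => (y F F F F x - Y2 x + y T T T T x) + 'i * (Y1 x - Y3 x)).
  apply: eq_bigr => x _; congr (`|_| ^+ 2).
  have i2 : 'i ^+ 2 = -1 :> C by exact: sqrCi.
  have i3 : 'i ^+ 3 = - 'i :> C by rewrite exprS i2 mulrN1.
  have i4 : 'i ^+ 4 = 1 :> C by rewrite (exprM _ 2 2) i2 sqrrN expr1n.
  rewrite /quads /= !big_cons big_nil /u /= /T /F !(addn0, add0n, addn1, addnS).
  rewrite expr0 expr1 i2 i3 i4 /Y1 /Y2 /Y3; ring.
move=> le16; move: le16; rewrite {}e16 sqnorm_yvec.
have -> : 16%:R * (weight F F F F * weight (~~ F) (~~ F) (~~ F) (~~ F)) =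
    (4%:R * (s F F F F * s T T T T)) ^+ 2.
  by rewrite !exprMn !sqrtCK -natrX.
rewrite ler_pXn2r // ?nnegrE ?mulr_ge0 ?ler0n ?sumr_ge0 //.
rewrite /quads /= !big_cons big_nil !big_bool /n /= => /le_trans; apply.
by rewrite le_eqVlt; apply/orP; left; apply/eqP; rewrite /s /T /F; ring.
Qed.

Definition l2norm (f : {set I} -> C) : C := sqrtC (\sum_A `|f A| ^+ 2).

Lemma l2norm_ge0 f : 0 <= l2norm f.
Proof. by rewrite sqrtC_ge0 sumr_ge0 // => A _; rewrite exprn_ge0. Qed.

Lemma l2norm_restrict0 : l2norm (restrict B set0 kappa) = sqrtC (weight false false false false).
Proof.
congr (sqrtC _); rewrite /weight [RHS]big_mkcond; apply: eq_bigr => A _.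
by rewrite /restrict setI_eq0; case: ifP; rewrite // normr0 expr0n.
Qed.

Lemma l2norm_restrictT : l2norm (restrict B B kappa) = sqrtC (weight true true true true).
Proof.
congr (sqrtC _); rewrite /weight [RHS]big_mkcond.
rewrite (reindex_inj (@symdiff_inj _ B)); apply: eq_bigr => A _.
rewrite /restrict; have -> : ((A :+: B) :&: B == B) = [disjoint A & B].
  rewrite -setI_eq0; apply/eqP/eqP => /setP AB; apply/setP => i; have := AB i;
    rewrite !(in_setI, in_symdiff, in_set0); by case: (i \in A) (i \in B) => [] [].
have -> : fourtuple true true true true A = A :+: B.
  by apply/setP => i; rewrite in_fourtuple in_symdiff mem_four !addbA.
by case: ifP; rewrite // normr0 expr0n.
Qed.

(** Let x_D be the root of the weight of D. The terms D = 0 and D = B on the right of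
    [weight_rotation] contribute 2 x_0 x_B, so 2 x_0 x_B is at most the sum of x_D x_(B\D) over the
    other D, which is at most the sum of their x_D^2. Adding x_0^2 + x_B^2 gives the square of the
    claim. *)
Lemma l2norm_restrict_le :
  l2norm (restrict B set0 kappa) + l2norm (restrict B B kappa) <= l2norm kappa.
Proof.
rewrite l2norm_restrict0 l2norm_restrictT.
have s_ge0 a b c d : 0 <= sqrtC (weight a b c d) by rewrite sqrtC_ge0 weight_ge0.
rewrite -(@ler_pXn2r _ 2) // ?nnegrE ?addr_ge0 ?l2norm_ge0 //.
rewrite sqrtCK weight_sum.
have wE a b c d : weight a b c d = sqrtC (weight a b c d) ^+ 2 by rewrite sqrtCK.
have := weight_rotation; rewrite !big_bool /=.
have sq (u v : C) : 0 <= u -> 0 <= v -> 0 <= (u - v) ^+ 2.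
  by move=> u0 v0; rewrite real_exprn_even_ge0 // rpredB ?ger0_real.
move=> rot; rewrite -subr_ge0; move: rot; rewrite -subr_ge0 => rot.
rewrite (wE true true true true) (wE true true true false) (wE true true false true)
  (wE true true false false) (wE true false true true) (wE true false true false)
  (wE true false false true) (wE true false false false)
  (wE false true true true) (wE false true true false) (wE false true false true)
  (wE false true false false) (wE false false true true) (wE false false true false)
  (wE false false false true) (wE false false false false).
apply: le_trans rot _.
rewrite -subr_ge0.
set w := weight.
(* One square for each of the seven pairs {D, B \ D} other than {0, B}. *)
rewrite [leRHS](_ : _ =
    (sqrtC (w false false false true) - sqrtC (w true true true false)) ^+ 2
  + (sqrtC (w false false true false) - sqrtC (w true true false true)) ^+ 2
  + (sqrtC (w false false true true) - sqrtC (w true true false false)) ^+ 2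
  + (sqrtC (w false true false false) - sqrtC (w true false true true)) ^+ 2
  + (sqrtC (w false true false true) - sqrtC (w true false true false)) ^+ 2
  + (sqrtC (w false true true false) - sqrtC (w true false false true)) ^+ 2
  + (sqrtC (w false true true true) - sqrtC (w true false false false)) ^+ 2).
  by rewrite !addr_ge0 // sq // s_ge0.
by rewrite !(sqrCK (s_ge0 _ _ _ _)); ring.
Qed.
End Pluecker.

(** * Sums of coefficients over unions of disjoint four-element blocks *)

Section DisjointBlocks.
Variables (C : numClosedFieldType) (N : nat).
Local Notation I := 'I_N.
Implicit Types (A B D : {set I}) (kappa : {set I} -> C) (L : seq {set I}).

Definition four_set B :=
  exists b0 b1 b2 b3 : I, uniq [:: b0; b1; b2; b3] /\ B = [set b0; b1; b2; b3].

(* Sum of |kappa (A :+: B)| over the unions B of subfamilies of L. *)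
Fixpoint block_sum kappa L A : C :=
  if L is B :: L' then block_sum kappa L' A + block_sum kappa L' (A :+: B)
  else `|kappa A|.

Lemma block_sum_restrict kappa L A B D :
  A :&: B = D -> all (fun B' => [disjoint B' & B]) L ->
  block_sum (restrict B D kappa) L A = block_sum kappa L A.
Proof.
elim: L A => [|B' L IH] A AD /=; first by rewrite /restrict AD eqxx.
case/andP=> B'B LB; rewrite !IH // -[RHS]AD; apply/setP => i.
rewrite !in_setI in_symdiff; case: (boolP (i \in B)) => iB; rewrite ?andbF //.
by rewrite (disjointFl B'B iB) addbF.
Qed.

(** Induction on the blocks: the head block [B] splits the sum into index sets avoiding [B] and
    index sets containing it. Each half is a sum of restricted coefficients, which satisfy the
    quadratic relations again, and [l2norm_restrict_le] adds the two bounds. *)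
Lemma block_sum_le kappa L A :
  pluecker kappa -> (forall B, B \in L -> four_set B) ->
  pairwise (fun B D => [disjoint B & D]) L ->
  all (fun B => [disjoint A & B]) L ->
  block_sum kappa L A <= l2norm kappa.
Proof.
elim: L kappa A => [|B L IH] kappa A pk L4 /=.
  move=> _ _; rewrite -(@ler_pXn2r _ 2) // ?nnegrE ?l2norm_ge0 // sqrtCK.
  by rewrite (bigD1 A) //= lerDl sumr_ge0 // => D _; rewrite exprn_ge0.
case/andP=> BL Lp /andP[AB AL].
have LB : all (fun B' => [disjoint B' & B]) L.
  by apply/allP => B' B'L; rewrite disjoint_sym; apply: (allP BL).
have [b0 [b1 [b2 [b3 [b_uniq BE]]]]] := L4 B (mem_head _ _).
have := l2norm_restrict_le b_uniq pk; rewrite -BE; apply: le_trans.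
have L4' B' : B' \in L -> four_set B' by move=> B'L; apply: L4; rewrite inE B'L orbT.
rewrite -(block_sum_restrict kappa (D := set0) _ LB); last first.
  by apply/eqP; rewrite setI_eq0.
rewrite -(block_sum_restrict kappa (A := A :+: B) (D := B) _ LB); last first.
  apply/setP => i; rewrite in_setI in_symdiff; case: (boolP (i \in B)) => iB; rewrite ?andbF //.
  by rewrite (disjointFl AB iB).
apply: lerD; apply: IH => //; try exact: pluecker_restrict.
apply/allP => B' B'L; rewrite -setI_eq0; apply/eqP/setP => i.
rewrite in_setI in_symdiff in_set0; case: (boolP (i \in B')) => iB'; rewrite ?andbF //.
by rewrite (disjointFl (allP AL _ B'L) iB') (disjointFr (allP LB _ B'L) iB').
Qed.
End DisjointBlocks.

(** * Majorana monomials *)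

Local Open Scope sesquilinear_scope.

Section Adjoint.
Variables (C : numClosedFieldType).

Lemma trmxCM m n p (A : 'M[C]_(m, n)) (B : 'M[C]_(n, p)) :
  (A *m B)^t* = B^t* *m A^t*.
Proof. by rewrite trmx_mul map_mxM. Qed.

Lemma trmxCZ m n a (A : 'M[C]_(m, n)) : (a *: A)^t* = a^* *: A^t*.
Proof. by apply/matrixP => i j; rewrite !mxE rmorphM. Qed.

Lemma trmxC1 n : (1%:M : 'M[C]_n)^t* = 1%:M.
Proof. by rewrite trmx1 map_mx1. Qed.

Lemma trmxCD m n (A B : 'M[C]_(m, n)) : (A + B)^t* = A^t* + B^t*.
Proof. by apply/matrixP => i j; rewrite !mxE rmorphD. Qed.

Lemma trmxC_sum m n (J : finType) (F : J -> 'M[C]_(m, n)) :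
  (\sum_j F j)^t* = \sum_j (F j)^t*.
Proof.
apply: (big_morph (fun X : 'M[C]_(m, n) => X^t*)); first exact: trmxCD.
by rewrite trmx0 map_mx0.
Qed.

Lemma unitarymxPl n (V : 'M[C]_n) : V \is unitarymx -> V^t* *m V = 1%:M.
Proof. by move=> /unitarymxP VV; apply: mulmx1C. Qed.
End Adjoint.

(** * Monomials in Clifford generators and the coefficients of a unitary *)

Section Clifford.
Variables (C : numClosedFieldType) (d N : nat) (c : 'I_N -> 'M[C]_d).
Local Notation I := 'I_N.
Implicit Types (A B E : {set I}).
Hypothesis d_gt0 : (0 < d)%N.
Hypothesis c_adj : forall i, (c i)^t* = c i.
Hypothesis c_sq : forall i, c i *m c i = 1%:M.
Hypothesis c_anti : forall i j, i != j -> c i *m c j = - (c j *m c i).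

Definition ntr (X : 'M[C]_d) : C := \tr X / d%:R.

Lemma ntrC X Y : ntr (X *m Y) = ntr (Y *m X).
Proof. by rewrite /ntr mxtrace_mulC. Qed.
Lemma ntr1 : ntr 1%:M = 1.
Proof. by rewrite /ntr mxtrace1 divff // pnatr_eq0 -lt0n. Qed.
Lemma ntrZ a X : ntr (a *: X) = a * ntr X.
Proof. by rewrite /ntr mxtraceZ mulrA. Qed.
Lemma ntrD X Y : ntr (X + Y) = ntr X + ntr Y.
Proof. by rewrite /ntr mxtraceD mulrDl. Qed.
Lemma ntrN X : ntr (- X) = - ntr X.
Proof. by rewrite -scaleN1r ntrZ mulN1r. Qed.
Lemma ntr_sum J (s : seq J) (P : pred J) F :
  ntr (\sum_(j <- s | P j) F j) = \sum_(j <- s | P j) ntr (F j).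
Proof. by rewrite /ntr raddf_sum mulr_suml. Qed.
Lemma ntr_adj X : ntr (X^t*) = (ntr X)^*.
Proof.
rewrite /ntr rmorphM fmorphV rmorph_nat; congr (_ / _).
by rewrite rmorph_sum; apply: eq_bigr => i _; rewrite !mxE.
Qed.

Lemma ntr_adj_mul_ge0 (X : 'M[C]_d) : 0 <= ntr (X^t* *m X).
Proof.
rewrite divr_ge0 ?ler0n // sumr_ge0 // => i _; rewrite mxE sumr_ge0 // => j _.
by rewrite !mxE mulrC mul_conjC_ge0.
Qed.

Fixpoint cword (s : seq I) A : 'M[C]_d :=
  if s is k :: s' then (if k \in A then c k *m cword s' A else cword s' A) else 1%:M.

Definition cmon A : 'M[C]_d := cword (enum I) A.

Lemma cword_toggle_notin s A i : i \notin s -> cword s (A :+: [set i]) = cword s A.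
Proof.
elim: s => //= k s IH; rewrite inE negb_or => /andP[ik /IH->].
by rewrite in_symdiff inE eq_sym (negbTE ik) addbF.
Qed.

(** Since the list is increasing, c_i collects one sign for each smaller element of [A] before
    reaching its place, where it cancels against c_i or is inserted. *)
Lemma cword_toggle s A i : sorted ltn (map val s) -> i \in s ->
  c i *m cword s A =
  (\prod_(k <- s | (k \in A) && (k < i)%N) -1) *: cword s (A :+: [set i]).
Proof.
elim: s => // k s IH; rewrite [sorted _ _]/= => ks.
rewrite inE big_cons; case: eqVneq => [ik _|ik /= iS].
  subst k; rewrite ltnn andbF.
  have lts : all (fun k : I => (i < k)%N) s.
    have := order_path_min ltn_trans ks; rewrite all_map; exact.
  rewrite big1_seq => [|k /andP[/andP[_ ki] kS]]; last first.
    by have := allP lts _ kS; rewrite ltnNge ltnW.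
  have iS : i \notin s by apply/negP => /(allP lts); rewrite ltnn.
  rewrite scale1r /= cword_toggle_notin // in_symdiff inE eqxx addbT.
  by case: (i \in A) => //=; rewrite mulmxA c_sq mul1mx.
have ki : (k < i)%N.
  have := order_path_min ltn_trans ks; rewrite all_map => /allP/(_ _ iS); exact.
rewrite ki andbT in_symdiff inE eq_sym (negbTE ik) addbF.
have {}IH := IH (path_sorted ks) iS.
case: (k \in A) => //; rewrite mulmxA c_anti // mulNmx -mulmxA IH.
by rewrite -scalemxAr mulN1r scaleNr.
Qed.

Lemma cmon_toggle A i : c i *m cmon A = jw_sign C i A *: cmon (A :+: [set i]).
Proof.
rewrite /cmon cword_toggle ?mem_enum //; last first.
  by rewrite val_enum_ord iota_ltn_sorted.
by congr (_ *: _); rewrite /jw_sign big_enum_cond.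
Qed.

Lemma cword_comm s A i :
  c i *m cword s A = (\prod_(k <- s | k \in A) (-1) ^+ (k != i)) *: (cword s A *m c i).
Proof.
elim: s => [|k s IH] /=; first by rewrite big_nil scale1r mulmx1 mul1mx.
rewrite big_cons; case: (k \in A) => //.
have -> : c i *m (c k *m cword s A) = (-1) ^+ (k != i) *: (c k *m (c i *m cword s A)).
  case: eqVneq => [->|ki]; first by rewrite scale1r.
  by rewrite expr1 scaleN1r !mulmxA -mulNmx c_anti // eq_sym.
by rewrite IH -scalemxAr scalerA mulmxA.
Qed.

(** Every factor but c_i itself anticommutes with c_i. The exponent adds the membership of [i] where
    one would subtract it, which has the same parity. *)
Lemma cmon_comm A i : c i *m cmon A = (-1) ^+ (#|A| + (i \in A)) *: (cmon A *m c i).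
Proof.
rewrite /cmon cword_comm big_enum_cond /=; congr (_ *: _).
have [iA|iA] := boolP (i \in A).
  rewrite (bigD1 i) //= eqxx mul1r (cardD1 i) iA addnAC /= exprD sqrrN expr1n mul1r.
  rewrite -prodr_const; apply: eq_big => [k|k /andP[_ ->//]].
  by rewrite !inE andbC.
rewrite addn0 -prodr_const; apply: eq_bigr => k kA.
by rewrite (memPn iA).
Qed.

Lemma cmon_unitary A : (cmon A)^t* *m cmon A = 1%:M.
Proof.
rewrite /cmon; elim: (enum I) => [|k s IH] /=; first by rewrite trmxC1 mulmx1.
by case: ifP => // _; rewrite trmxCM c_adj mulmxA -[_ *m c k *m c k]mulmxA c_sq mulmx1.
Qed.

Lemma cmon_toggle_right A i : exists z : C, `|z| = 1 /\
  cmon A *m c i = z *: cmon (A :+: [set i]).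
Proof.
have := cmon_comm A i; rewrite cmon_toggle => e.
exists ((-1) ^+ (#|A| + (i \in A)) * jw_sign C i A); split.
  by rewrite normrM norm_jw_sign normrX normrN1 expr1n mulr1.
by rewrite -scalerA e scalerA -exprD addnn -mul2n exprM sqrrN !expr1n scale1r.
Qed.

Lemma odd_toggle A i : odd #|A :+: [set i]| = ~~ odd #|A|.
Proof.
have [iA|iA] := boolP (i \in A).
  rewrite [in RHS](cardsD1 i) iA /= negbK; congr (odd #|pred_of_set _|).
  by apply/setP => k; rewrite !inE; case: (eqVneq k i) => [->|]; rewrite ?iA ?addbF.
rewrite -[#|_|]/(#|pred_of_set _|).
have -> : A :+: [set i] = i |: A.
  by apply/setP => k; rewrite !inE; case: (eqVneq k i) => [->|]; rewrite ?(negbTE iA) ?addbF.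
by rewrite cardsU1 iA.
Qed.

(** For even sets, conjugation by c_i multiplies a monomial by -1 exactly if [i] belongs to its
    index set. Taking [i] in just one of [A] and [B] shows that the trace equals its own
    negative. *)
Lemma cmon_ortho A B : ~~ odd #|A| -> ~~ odd #|B| -> A != B ->
  ntr ((cmon A)^t* *m cmon B) = 0.
Proof.
move=> eA eB AB.
have [i iAB] : exists i, (i \in A) != (i \in B).
  apply/existsP; apply: contraNT AB => /existsPn AB.
  by apply/eqP/setP => i; apply/eqP; have := AB i; rewrite negbK.
set X := ntr _; suff: X = - X.
  by move/eqP; rewrite -addr_eq0 -mulr2n mulrn_eq0 /= => /eqP.
have sg (D : {set I}) : ~~ odd #|D| -> c i *m cmon D *m c i = (-1) ^+ (i \in D) *: cmon D.
  move=> eD; rewrite cmon_comm -scalemxAl -mulmxA c_sq mulmx1.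
  by rewrite exprD -signr_odd (negbTE eD) mul1r.
rewrite {1}/X -[X in ntr X]mul1mx -(c_sq i) -mulmxA ntrC.
have -> : c i *m ((cmon A)^t* *m cmon B) *m c i =
  (c i *m cmon A *m c i)^t* *m (c i *m cmon B *m c i).
  by rewrite !trmxCM !c_adj !mulmxA -[_ *m c i *m c i]mulmxA c_sq mulmx1.
rewrite !sg // trmxCZ -scalemxAl -scalemxAr !ntrZ -/X.
by rewrite rmorphXn rmorphN1; case: (i \in A) (i \in B) iAB => [] [] //= _;
  rewrite !expr1 !expr0 ?mul1r ?mulN1r.
Qed.

(* Only even coefficients are ever needed, and setting the odd ones to 0 makes *)
(* it unnecessary to know that K has a definite parity.                       *)
Definition coeff (K : 'M[C]_d) A : C :=
  if odd #|A| then 0 else ntr ((cmon A)^t* *m K).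

(** Bessel's inequality: with S the projection of K onto the even monomials, the squared norm of K -
    S is 1 minus the sum of the |coeff|^2. *)
Lemma coeff_bessel K : K \is unitarymx -> l2norm (coeff K) <= 1.
Proof.
move=> KU; rewrite -(@ler_pXn2r _ 2) // ?nnegrE ?l2norm_ge0 ?ler01 // sqrtCK expr1n.
pose S := \sum_A coeff K A *: cmon A.
have := ntr_adj_mul_ge0 (K - S).
have -> : (K - S)^t* = K^t* - S^t*.
  by apply/matrixP => i j; rewrite !mxE rmorphB.
rewrite mulmxBl !mulmxBr unitarymxPl // ntrD !ntrN !ntrD !ntrN ntr1.
have Sadj : S^t* = \sum_A (coeff K A)^* *: (cmon A)^t*.
  by rewrite trmxC_sum; apply: eq_bigr => A _; rewrite trmxCZ.
have SK : ntr (S^t* *m K) = \sum_A `|coeff K A| ^+ 2.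
  rewrite Sadj mulmx_suml ntr_sum; apply: eq_bigr => A _.
  rewrite -scalemxAl ntrZ /coeff; case: ifP => _; first by rewrite rmorph0 mul0r normr0 expr0n.
  by rewrite normCKC.
have KS : ntr (K^t* *m S) = \sum_A `|coeff K A| ^+ 2.
  have -> : K^t* *m S = (S^t* *m K)^t* by rewrite trmxCM trmxCK.
  by rewrite ntr_adj SK geC0_conj ?sumr_ge0 // => A _; rewrite exprn_ge0.
have SS : ntr (S^t* *m S) = \sum_A `|coeff K A| ^+ 2.
  have -> : ntr (S^t* *m S) = \sum_A \sum_B (coeff K B)^* * coeff K A * ntr ((cmon B)^t* *m cmon A).
    rewrite {2}/S mulmx_sumr ntr_sum; apply: eq_bigr => A _.
    rewrite Sadj -scalemxAr ntrZ mulmx_suml ntr_sum mulr_sumr; apply: eq_bigr => B _.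
    by rewrite -scalemxAl ntrZ; ring.
  apply: eq_bigr => A _; rewrite (bigD1 A) //= cmon_unitary ntr1 mulr1 -normCKC.
  rewrite big1 ?addr0 // => B BA; rewrite /coeff.
  case: ifP => [|oB]; first by rewrite rmorph0 !mul0r.
  case: ifP => [|oA]; first by rewrite mulr0 mul0r.
  by rewrite cmon_ortho ?oA ?oB ?mulr0.
rewrite SK KS SS => h; rewrite -subr_ge0; apply: le_trans h _.
by rewrite le_eqVlt; apply/orP; left; apply/eqP; ring.
Qed.

Lemma jw_sign_symdiff i A E : jw_sign C i A * jw_sign C i (A :+: E) = jw_sign C i E.
Proof.
rewrite /jw_sign [X in X * _]big_mkcond [X in _ * X]big_mkcond [RHS]big_mkcond.
rewrite -big_split; apply: eq_bigr => k _.
rewrite in_symdiff; case: (k < i)%N; rewrite ?andbF ?andbT /= ?mulr1 //.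
by case: (k \in A) (k \in E) => [] [] /=; ring.
Qed.

(** The sums of K c_i (x) K c_i and of c_i K (x) c_i K over i agree. Their components at ([A],
    [A :+: E]) with both sets odd have equal terms for i outside [E] and opposite terms for i in
    [E], so the latter sum to zero. For the other parities every term contains an odd coefficient,
    which is 0. *)
Lemma coeff_pluecker (K : 'M[C]_d) (O : 'M[C]_N) :
  O^T *m O = 1%:M -> (forall j, K *m c j = \sum_k O j k *: (c k *m K)) ->
  pluecker (coeff K).
Proof.
move=> OO Kc A E; pose A' := A :+: E.
have vanish (D : {set I}) i : ~~ odd #|D| -> coeff K (D :+: [set i]) = 0.
  by move=> eD; rewrite /coeff odd_toggle eD.
have [oA|eA] := boolP (odd #|A|); last by rewrite big1 // => i _; rewrite vanish ?mul0r ?mulr0.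
have [oA'|eA'] := boolP (odd #|A'|); last first.
  by rewrite big1 // => i _; rewrite (vanish A') ?mulr0.
have left (D : {set I}) i : odd #|D| ->
    ntr ((cmon D)^t* *m (c i *m K)) = jw_sign C i D * coeff K (D :+: [set i]).
  move=> oD; rewrite /coeff odd_toggle oD /= mulmxA -[in LHS](c_adj i) -trmxCM cmon_toggle.
  by rewrite trmxCZ jw_sign_real -scalemxAl ntrZ.
have right (D : {set I}) i : odd #|D| -> ntr ((cmon D)^t* *m (K *m c i)) =
    - (-1) ^+ (i \in D) * (jw_sign C i D * coeff K (D :+: [set i])).
  move=> oD; rewrite mulmxA ntrC mulmxA -left // mulmxA.
  rewrite -[X in ntr (X *m _) = _](_ : (cmon D *m c i)^t* = _); last by rewrite trmxCM c_adj.
  have -> : cmon D *m c i = (- (-1) ^+ (i \in D)) *: (c i *m cmon D).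
    rewrite cmon_comm scalerA exprD -(signr_odd _ #|D|) oD expr1 mulN1r mulrNN -expr2.
    by rewrite sqrr_sign scale1r.
  by rewrite trmxCZ rmorphN rmorphXn rmorphN1 -scalemxAl ntrZ trmxCM c_adj.
(* Orthogonality of the columns of [O] collapses the double sum over k and l to its diagonal. *)
have sum_eq : \sum_i ntr ((cmon A)^t* *m (K *m c i)) * ntr ((cmon A')^t* *m (K *m c i)) =
    \sum_i ntr ((cmon A)^t* *m (c i *m K)) * ntr ((cmon A')^t* *m (c i *m K)).
  have ex D j : ntr ((cmon D)^t* *m (K *m c j)) = \sum_k O j k * ntr ((cmon D)^t* *m (c k *m K)).
    by rewrite Kc mulmx_sumr ntr_sum; apply: eq_bigr => k _; rewrite -scalemxAr ntrZ.
  under eq_bigr do rewrite !ex mulr_suml.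
  rewrite exchange_big; apply: eq_bigr => k _ /=.
  under eq_bigr do rewrite mulr_sumr.
  rewrite exchange_big (bigD1 k) //= [X in _ + X]big1 => [|l lk].
    have /matrixP/(_ k k) := OO; rewrite !mxE eqxx => e.
    rewrite addr0 -[RHS]mul1r -[1]e mulr_suml; apply: eq_bigr => j _; rewrite mxE; ring.
  have /matrixP/(_ k l) := OO; rewrite !mxE eq_sym (negbTE lk) /= => e.
  rewrite -[RHS](mul0r (ntr ((cmon A)^t* *m (c k *m K)) * ntr ((cmon A')^t* *m (c l *m K)))).
  by rewrite -[X in X * _]e mulr_suml; apply: eq_bigr => j _; rewrite mxE; ring.
pose F i := jw_sign C i E * (coeff K (A :+: [set i]) * coeff K (A' :+: [set i])).
have eF i : ntr ((cmon A)^t* *m (c i *m K)) * ntr ((cmon A')^t* *m (c i *m K)) = F i.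
  by rewrite !left // /F -(jw_sign_symdiff i A E); ring.
(* By [right], exchanging left for right multiplication costs -(-1)^[i in D] for an odd set D; for
   [A] and [A'] together this is -1 exactly on [E]. *)
have eG i : ntr ((cmon A)^t* *m (K *m c i)) * ntr ((cmon A')^t* *m (K *m c i)) =
    (if i \in E then - F i else F i).
  rewrite !right // /F -(jw_sign_symdiff i A E) /A' in_symdiff.
  by case: (i \in A) (i \in E) => [] [] /=; rewrite ?expr0 ?expr1; ring.
move: sum_eq; under eq_bigr do rewrite eG; under [in RHS]eq_bigr do rewrite eF.
rewrite (bigID (mem E)) [RHS](bigID (mem E)) /=.
rewrite [X in _ + X = _](eq_bigr F) => [|i /negbTE->//]; move/addIr.
rewrite (eq_bigr (fun i => - F i)) => [|i ->//]; rewrite sumrN => /esym/eqP.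
by rewrite -addr_eq0 -mulr2n mulrn_eq0 /= => /eqP.
Qed.

Fixpoint rprod (J : Type) (F : J -> 'M[C]_d) (L : seq J) : 'M[C]_d :=
  if L is s :: L' then rprod F L' *m F s else 1%:M.

(** * Traces against products of factors 1 + w Q with quartic Q *)

Section FourBlocks.
Variables (J : Type) (b0 b1 b2 b3 : J -> I) (z w : J -> C).
Hypothesis b_uniq : forall s, uniq [:: b0 s; b1 s; b2 s; b3 s].
Hypothesis z_norm : forall s, `|z s| = 1.
Hypothesis w_norm : forall s, `|w s| = 1.

(** Abstract form of Z (x) Z on a pair of qubits, for which the phase [z] is -1. *)
Let quartic s := z s *: (c (b0 s) *m c (b1 s) *m c (b2 s) *m c (b3 s)).
Let block s := [set b0 s; b1 s; b2 s; b3 s].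
Hypothesis quartic_adj : forall s, (quartic s)^t* = quartic s.

Lemma cmon_quartic A s : exists x : C, `|x| = 1 /\
  cmon A *m quartic s = x *: cmon (A :+: block s).
Proof.
have [x0 [n0 e0]] := cmon_toggle_right A (b0 s).
have [x1 [n1 e1]] := cmon_toggle_right (A :+: [set b0 s]) (b1 s).
have [x2 [n2 e2]] := cmon_toggle_right (A :+: [set b0 s] :+: [set b1 s]) (b2 s).
have [x3 [n3 e3]] := cmon_toggle_right (A :+: [set b0 s] :+: [set b1 s] :+: [set b2 s]) (b3 s).
exists (z s * (x0 * (x1 * (x2 * x3)))); split.
  by rewrite !normrM z_norm n0 n1 n2 n3 !mulr1.
rewrite -(symdiff_four (b_uniq s)) /quartic -scalemxAr !mulmxA e0 -!scalemxAl e1.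
by rewrite -!scalemxAl e2 -!scalemxAl e3 !scalerA !mulrA.
Qed.

(** Expand the head factor: its identity part keeps [A], and its quartic part, being selfadjoint, is
    absorbed by the adjoint monomial and moves [A] to [A :+: block s] up to a phase. Evenness is
    preserved, and the triangle inequality follows the recursion of [block_sum]. *)
Lemma rprod_block_sum K L A : ~~ odd #|A| ->
  `|ntr (rprod (fun s => 1%:M + w s *: quartic s) L *m (cmon A)^t* *m K)|
  <= block_sum (coeff K) (map block L) A.
Proof.
elim: L A => [|s L IH] A eA /=.
  by rewrite mul1mx /coeff (negbTE eA).
have [x [x1 ex]] := cmon_quartic A s.
have eAs : ~~ odd #|A :+: block s|.
  by rewrite -(symdiff_four (b_uniq s)) !odd_toggle !negbK.
set W := rprod _ _; have -> : W *m (1%:M + w s *: quartic s) *m (cmon A)^t* *m K =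
    W *m (cmon A)^t* *m K + (w s * x^*) *: (W *m (cmon (A :+: block s))^t* *m K).
  rewrite mulmxDr mulmx1 !mulmxDl; congr (_ + _).
  have -> : (cmon (A :+: block s))^t* = x *: (cmon A *m quartic s)^t*.
    by rewrite ex trmxCZ scalerA -normCK x1 expr1n scale1r.
  rewrite trmxCM quartic_adj; move: (quartic s) => q.
  rewrite -scalemxAr -!scalemxAl -scalemxAr -scalemxAl scalerA -mulrA [_^* * _]mulrC.
  by rewrite -normCK x1 expr1n mulr1 !mulmxA.
rewrite ntrD ntrZ; apply: le_trans (ler_normD _ _) _.
rewrite (normrM (w s * _)) (normrM (w s)) norm_conjC w_norm x1 !mul1r.
by apply: lerD; apply: IH.
Qed.

(** For empty [A] the sum over unions of blocks is at most the norm of the coefficients by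
    [block_sum_le], hence at most 1 by [coeff_bessel]. *)
Lemma rprod_norm_le1 K (O : 'M[C]_N) L :
  K \is unitarymx -> O^T *m O = 1%:M ->
  (forall j, K *m c j = \sum_k O j k *: (c k *m K)) ->
  pairwise (fun s s' => [disjoint block s & block s']) L ->
  `|ntr (rprod (fun s => 1%:M + w s *: quartic s) L *m K)| <= 1.
Proof.
move=> KU OO KO dL; have cm0 : cmon set0 = 1%:M.
  by rewrite /cmon; elim: (enum I) => //= k s ->; rewrite inE.
have := rprod_block_sum K L (A := set0).
rewrite cards0 cm0 trmxC1 mulmx1 => /(_ isT) /le_trans; apply.
apply: le_trans (coeff_bessel KU); apply: block_sum_le.
- exact: coeff_pluecker OO KO.
- elim: L {dL} => //= s L IH B; rewrite inE => /predU1P[->|/IH//].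
  by exists (b0 s), (b1 s), (b2 s), (b3 s).
- by rewrite pairwise_map.
- by apply/allP => B _; rewrite -setI_eq0 set0I.
Qed.
End FourBlocks.
End Clifford.

(** * Gaussian unitaries *)

From mathcomp Require Import perm mxtens complex.
From mathcomp Require Import all_classical all_reals all_analysis.
Import Order.TTheory GRing.Theory Num.Theory.
Import numFieldNormedType.Exports.
Local Open Scope ring_scope.
Local Open Scope sesquilinear_scope.
Local Open Scope complex_scope.

(** * Pauli matrices, tensor products of one-qubit operators and Majorana relations *)

Section Qubits.
Variable R : realType.
Local Notation C := R[i].

Lemma sqr_ii : @ii R * ii = -1.
Proof. by apply/eqP; rewrite eq_complex /= !(mul0r, mulr0, mul1r, add0r, addr0, sub0r, oppr0) !eqxx. Qed.

Lemma conj_ii : Num.conj (@ii R) = - ii.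
Proof. by apply/eqP; rewrite eq_complex /= oppr0 !eqxx. Qed.

Lemma conj_Nii : Num.conj (- @ii R) = ii.
Proof. by apply/eqP; rewrite eq_complex /= oppr0 opprK !eqxx. Qed.

Lemma conj_real (x : R) : Num.conj (x%:C) = x%:C.
Proof. by rewrite -[LHS]/(x -i* 0) oppr0. Qed.

Lemma mx2M (a b c d a' b' c' d' : C) :
  mx2 a b c d *m mx2 a' b' c' d' =
  mx2 (a * a' + b * c') (a * b' + b * d') (c * a' + d * c') (c * b' + d * d').
Proof.
apply/matrixP => i j; rewrite !mxE !big_ord_recl big_ord0 !mxE addr0 /=.
by case: i => [[|[|]]]; case: j => [[|[|]]].
Qed.

Lemma mx2_adj (a b c d : C) : (mx2 a b c d)^t* =
  mx2 (Num.conj a) (Num.conj c) (Num.conj b) (Num.conj d).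
Proof.
apply/matrixP => i j; rewrite !mxE.
by case: i => [[|[|]]]; case: j => [[|[|]]].
Qed.

Lemma mx2Z (x a b c d : C) : x *: mx2 a b c d = mx2 (x * a) (x * b) (x * c) (x * d).
Proof.
by apply/matrixP => i j; rewrite !mxE; case: i => [[|[|]]]; case: j => [[|[|]]].
Qed.

Lemma mx2_1 : (1%:M : 'M[C]_2) = mx2 1 0 0 1.
Proof.
by apply/matrixP => i j; rewrite !mxE; case: i => [[|[|]]] //; case: j => [[|[|]]].
Qed.

Section QubitTensor.
Variable n : nat.
Implicit Types P Q : 'I_n -> 'M[C]_2.

Lemma eq_qubit_tensor P Q : P =1 Q -> qubit_tensor P = qubit_tensor Q.
Proof. by move=> PQ; apply/matrixP => x y; rewrite !mxE; apply: eq_bigr => i _; rewrite PQ. Qed.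

Lemma bit_inj (x y : 'I_(qdim n)) : bit x =1 bit y -> x = y.
Proof. by move=> xy; apply: enum_val_inj; apply/ffunP. Qed.

Lemma qubit_tensorM P Q :
  qubit_tensor P *m qubit_tensor Q = qubit_tensor (fun i => P i *m Q i).
Proof.
apply/matrixP => x y; rewrite !mxE.
under [RHS]eq_bigr do rewrite mxE.
rewrite bigA_distr_bigA /= (reindex_onto enum_rank enum_val) /=; last by move=> i _; rewrite enum_valK.
apply: eq_big => [f|f _]; first by rewrite enum_rankK eqxx.
by rewrite !mxE -big_split; apply: eq_bigr => i _; rewrite /bit enum_rankK.
Qed.

Lemma qubit_tensor1 : qubit_tensor (fun _ : 'I_n => 1%:M) = (1%:M : 'M[C]_(qdim n)).
Proof.
apply/matrixP => x y; rewrite !mxE; case: eqVneq => [->|xy].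
  by rewrite big1 // => i _; rewrite mxE eqxx.
have [i xyi] : exists i, bit x i != bit y i.
  by apply/existsP; apply: contraNT xy => /existsPn xy; apply/eqP/bit_inj => i;
    apply/eqP; have := xy i; rewrite negbK.
by rewrite (bigD1 i) //= mxE (negbTE xyi) mul0r.
Qed.

Lemma qubit_tensor_adj P : (qubit_tensor P)^t* = qubit_tensor (fun i => (P i)^t*).
Proof.
apply/matrixP => x y; rewrite !mxE rmorph_prod; apply: eq_bigr => i _.
by rewrite !mxE.
Qed.

Lemma qubit_tensorZ (a : 'I_n -> C) P :
  qubit_tensor (fun i => a i *: P i) = (\prod_i a i) *: qubit_tensor P.
Proof.
by apply/matrixP => x y; rewrite !mxE -big_split; apply: eq_bigr => i _; rewrite mxE.
Qed.

Definition set_qubit i (A : 'M[C]_2) P k := if k == i then A else P k.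
Definition on_qubit i A := qubit_tensor (set_qubit i A (fun _ => 1%:M)).

Lemma qubit_tensor_setD i A B P :
  qubit_tensor (set_qubit i (A + B) P) =
  qubit_tensor (set_qubit i A P) + qubit_tensor (set_qubit i B P).
Proof.
apply/matrixP => x y; rewrite !mxE !(bigD1 (P := predT) i) //= /set_qubit eqxx mxE mulrDl.
by congr (_ * _ + _ * _); apply: eq_bigr => k /negbTE ->.
Qed.

Lemma qubit_tensor_setZ i a A P :
  qubit_tensor (set_qubit i (a *: A) P) = a *: qubit_tensor (set_qubit i A P).
Proof.
apply/matrixP => x y; rewrite !mxE !(bigD1 (P := predT) i) //= /set_qubit eqxx mxE -mulrA.
by congr (_ * (_ * _)); apply: eq_bigr => k /negbTE ->.
Qed.
End QubitTensor.

Section Majorana.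
Variable n : nat.

Lemma majorana_adj m : (@majorana R n m)^t* = majorana m.
Proof.
rewrite /majorana qubit_tensor_adj; apply: eq_qubit_tensor => i.
have [X Y Z] : [/\ (@PX R)^t* = PX, (@PY R)^t* = PY & (@PZ R)^t* = PZ].
  by split; rewrite [LHS]mx2_adj; congr mx2;
    rewrite ?conj_Nii ?conj_ii ?rmorphN1 ?rmorph0 ?rmorph1.
by do ?case: ifP => _ //; rewrite trmxC1.
Qed.

Lemma majorana_sq m : @majorana R n m *m majorana m = 1%:M.
Proof.
rewrite /majorana qubit_tensorM -qubit_tensor1; apply: eq_qubit_tensor => i.
have [X Y Z] : [/\ @PX R *m PX = 1%:M, @PY R *m PY = 1%:M & @PZ R *m PZ = 1%:M].
  by split; rewrite mx2M mx2_1; congr mx2; rewrite ?mulNr ?mulrN ?sqr_ii; ring.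
by do ?case: ifP => _ //; rewrite mulmx1.
Qed.

Lemma pauliXY : @PX R *m PY = ii *: PZ.
Proof.
by rewrite mx2M mx2Z; congr mx2; ring.
Qed.
Lemma pauliYX : @PY R *m PX = - ii *: PZ.
Proof.
by rewrite mx2M mx2Z; congr mx2; ring.
Qed.
Lemma pauliYZ : @PY R *m PZ = ii *: PX.
Proof.
by rewrite mx2M mx2Z; congr mx2; ring.
Qed.
Lemma pauliZY : @PZ R *m PY = - ii *: PX.
Proof.
by rewrite mx2M mx2Z; congr mx2; ring.
Qed.
Lemma pauliXZ : @PX R *m PZ = - ii *: PY.
Proof.
rewrite mx2M mx2Z; congr mx2; rewrite ?mulNr ?mulrN ?sqr_ii; ring.
Qed.
Lemma pauliZX : @PZ R *m PX = ii *: PY.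
Proof.
rewrite mx2M mx2Z; congr mx2; rewrite ?mulNr ?mulrN ?sqr_ii; ring.
Qed.

Lemma majorana_anti m l : m != l ->
  @majorana R n m *m majorana l = - (majorana l *m majorana m).
Proof.
wlog lml : m l / (m./2 <= l./2)%N.
  move=> H ml; have [/H->//|lm] := leqP m./2 l./2.
  by rewrite (H l m) ?opprK 1?ltnW 1?eq_sym.
move=> ml; rewrite /majorana !qubit_tensorM.
have mn : (m./2 < n)%N.
  by rewrite ltn_half_double -mul2n.
pose i0 := Ordinal mn.
set f := fun i => _; set g := fun i => _.
(* The sign is put on the tensor factor at the qubit of [m]: as this qubit is not after that of [l],
   it is the only place where the two operators anticommute. *)
have <- : qubit_tensor (fun i => (if i == i0 then -1 else 1) *: g i) = - qubit_tensor g.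
  by rewrite qubit_tensorZ -big_mkcond big_pred1_eq scaleN1r.
apply: eq_qubit_tensor => i; rewrite /f /g -val_eqE /=.
have [im|im|im] := ltngtP i m./2.
- by rewrite (leq_trans im lml) scale1r.
- by case: ifP => _; rewrite ?mulmx1 ?mul1mx ?scale1r //; case: ifP => _; rewrite scale1r.
case: (ltngtP m./2 l./2) lml => // [lt _|e _].
  rewrite !im lt scaleN1r; case: (odd m); rewrite ?pauliYZ ?pauliZY ?pauliXZ ?pauliZX.
    by rewrite scaleNr opprK.
  by rewrite scaleNr.
have : odd m != odd l.
  apply: contraNneq ml => oml; apply/eqP/val_inj.
  by rewrite /= -(odd_double_half m) -(odd_double_half l) oml e.
rewrite im e ltnn eqxx; case: (odd m) (odd l) => [] [] //= _;
  rewrite scaleN1r pauliXY pauliYX ?scaleNr ?opprK //.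
Qed.
End Majorana.
End Qubits.

(** * Closure properties of Gaussian unitaries; unit vectors are Gaussian *)

Section Gaussian.
Variable R : realType.
Local Notation C := R[i].
Variable n : nat.
Local Notation maj := (@majorana R n).
Implicit Types V W : 'M[C]_(qdim n).

Lemma gaussian_unitary V : gaussian V -> V \is unitarymx.
Proof. by case. Qed.

Lemma gaussian1 : gaussian (1%:M : 'M[C]_(qdim n)).
Proof.
split; first by apply/unitarymxP; rewrite trmxC1 mulmx1.
exists 1%:M; split=> [|j]; first by rewrite trmx1 mulmx1.
rewrite trmxC1 mul1mx mulmx1 (bigD1 j) //= big1 ?addr0 => [|k kj].
  by rewrite !mxE eqxx scale1r.
by rewrite mxE eq_sym (negbTE kj) scale0r.
Qed.

Lemma gaussianM V W : gaussian V -> gaussian W -> gaussian (V *m W).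
Proof.
move=> [VU [S [SS VS]]] [WU [S' [SS' WS]]]; split.
  apply/unitarymxP; rewrite trmxCM mulmxA -[V *m W *m _]mulmxA.
  move/unitarymxP: WU => ->; rewrite mulmx1.
  by move/unitarymxP: VU.
(* [W] acts first on the generators and [V] then rotates the result, which reverses the order of the
   matrices. *)
exists (S' *m S); split=> [|j].
  by rewrite trmx_mul mulmxA -(mulmxA S') SS mulmx1.
rewrite trmxCM !mulmxA -(mulmxA V W) -(mulmxA V) WS mulmx_sumr mulmx_suml.
under eq_bigr => k _ do rewrite -scalemxAr -scalemxAl VS scaler_sumr.
rewrite exchange_big; apply: eq_bigr => k _ /=.
rewrite mxE rmorph_sum scaler_suml; apply: eq_bigr => l _.
by rewrite scalerA rmorphM.
Qed.

Lemma gaussianZ (z : C) V : z * Num.conj z = 1 -> gaussian V -> gaussian (z *: V).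
Proof.
move=> z1 [VU [S [SS VS]]]; split.
  by apply/unitarymxP; rewrite trmxCZ -scalemxAl -scalemxAr scalerA z1 scale1r;
    apply/unitarymxP.
exists S; split=> // j.
by rewrite trmxCZ -!scalemxAl -scalemxAr scalerA z1 scale1r VS.
Qed.

Lemma gaussian_adj V : gaussian V -> gaussian (V^t*).
Proof.
move=> [VU [S [SS VS]]]; split; first by rewrite trmxC_unitary.
have SS' : S^T *m S = 1%:M by apply: mulmx1C.
exists S^T; split=> [|j]; first by rewrite trmxK.
(* Orthogonality of [S] recovers each generator from its conjugates under [V], which conjugation by
   the adjoint then undoes. *)
have -> : maj j = \sum_k (S k j)%:C *: (V *m maj k *m V^t*).
  under eq_bigr => k _ do rewrite VS scaler_sumr.
  rewrite exchange_big (bigD1 j) //= [X in _ + X]big1 => [|l lj]; rewrite -?scaler_suml.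
    rewrite addr0; have /matrixP/(_ j j) := SS'; rewrite !mxE eqxx => e.
    under eq_bigr do rewrite scalerA -rmorphM.
    rewrite -scaler_suml -rmorph_sum -[LHS]scale1r; congr (_ *: _).
    rewrite -[LHS]/(1%:C) -[X in X%:C]e; congr (_%:C).
    by apply: eq_bigr => k _; rewrite mxE.
  have /matrixP/(_ j l) := SS'; rewrite !mxE eq_sym (negbTE lj) => e.
  under eq_bigr do rewrite scalerA -rmorphM.
  rewrite -scaler_suml -rmorph_sum -[RHS](scale0r (maj l)); congr (_ *: _).
  rewrite -[RHS]/(0%:C) -[X in _ = X%:C]e; congr (_%:C).
  by apply: eq_bigr => k _; rewrite mxE.
rewrite trmxCK mulmx_sumr mulmx_suml; apply: eq_bigr => k _.
rewrite mxE -scalemxAr -scalemxAl !mulmxA unitarymxPl // mul1mx.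
by rewrite -mulmxA unitarymxPl // mulmx1.
Qed.

Lemma gaussian_comm V : gaussian V -> exists S : 'M[C]_(2 * n),
  S^T *m S = 1%:M /\ forall j, V *m maj j = \sum_k S j k *: (maj k *m V).
Proof.
move=> [VU [S [SS VS]]]; exists (map_mx (real_complex R) S); split.
  by rewrite map_trmx -map_mxM (mulmx1C SS) map_mx1.
move=> j; have := congr1 (fun X => X *m V) (VS j).
rewrite /= -mulmxA unitarymxPl // mulmx1 => ->.
by rewrite mulmx_suml; apply: eq_bigr => k _; rewrite mxE -scalemxAl.
Qed.

Lemma majorana_ac m l : maj m *m maj l + maj l *m maj m = ((m == l)%:R *+ 2) *: 1%:M.
Proof.
case: eqVneq => [->|ml]; first by rewrite majorana_sq mulr2n scalerDl scale1r.
by rewrite majorana_anti // addNr mul0rn scale0r.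
Qed.

Definition vecmaj (v : 'I_(2 * n) -> R) := \sum_k (v k)%:C *: maj k.

(** The vector u is selfadjoint with u^2 = 1, and u c_j + c_j u = 2 v_j gives u c_j u = 2 v_j u -
    c_j: the negative of the reflection in v. *)
Lemma gaussian_vecmaj v : \sum_k v k ^+ 2 = 1 -> gaussian (vecmaj v).
Proof.
move=> v1; set u := vecmaj v.
have ac j : u *m maj j + maj j *m u = ((v j)%:C *+ 2) *: 1%:M.
  rewrite /u /vecmaj mulmx_suml mulmx_sumr -big_split /=.
  under eq_bigr do rewrite -scalemxAl -scalemxAr -scalerDr majorana_ac scalerA.
  rewrite -scaler_suml (bigD1 j) //= eqxx big1 => [|k kj]; last by rewrite (negbTE kj) mul0rn mulr0.
  by rewrite addr0 mulrnAr mulr1.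
have u2 : u *m u = 1%:M.
  have : u *m u + u *m u = \sum_k (v k)%:C *: (u *m maj k + maj k *m u).
    rewrite (eq_bigr (fun k => u *m ((v k)%:C *: maj k) + ((v k)%:C *: maj k) *m u)).
      by rewrite big_split -mulmx_sumr -mulmx_suml.
    by move=> k _; rewrite -scalemxAl -scalemxAr scalerDr.
  under eq_bigr do rewrite ac scalerA mulrnAr -rmorphM.
  rewrite -scaler_suml sumrMnl.
  have -> : \sum_k (v k * v k)%:C = 1 :> C by rewrite -[RHS]/(1%:C) -v1 rmorph_sum.
  move=> e; apply: (@scalerI _ _ (2%:R : C)); first by rewrite pnatr_eq0.
  by rewrite !scaler_nat !mulr2n e mulr2n scalerDl scale1r.
have uadj : u^t* = u.
  by rewrite /u /vecmaj trmxC_sum; apply: eq_bigr => k _; rewrite trmxCZ conj_real majorana_adj.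
split; first by apply/unitarymxP; rewrite uadj.
(* The matrix 2 v v^T - 1, which is orthogonal as v is a unit vector. *)
exists (\matrix_(j, k) (v j * v k *+ 2 - (j == k)%:R)); split.
  apply/matrixP => j k; rewrite !mxE.
  transitivity (\sum_l (4%:R * v j * v k * v l ^+ 2 - (v j * v l *+ 2) * (k == l)%:R
     - (v k * v l *+ 2) * (j == l)%:R + (j == l)%:R * (k == l)%:R)).
    apply: eq_bigr => l _; rewrite !mxE; ring.
  rewrite !big_split /= -mulr_sumr v1 mulr1 !sumrN.
  have dl (F : 'I_(2 * n) -> R) m : \sum_l F l * (m == l)%:R = F m.
    rewrite (bigD1 m) //= eqxx mulr1 big1 ?addr0 // => l lm.
    by rewrite eq_sym (negbTE lm) mulr0.
  by rewrite !dl eq_sym; ring.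
move=> j; rewrite uadj.
have -> : u *m maj j *m u = ((v j)%:C *+ 2) *: u - maj j.
  have -> : u *m maj j = ((v j)%:C *+ 2) *: 1%:M - maj j *m u by rewrite -ac addrK.
  by rewrite mulmxBl -mulmxA u2 mulmx1 -scalemxAl mul1mx.
rewrite {1}/u /vecmaj scaler_sumr.
have -> : maj j = \sum_k (j == k)%:R%:C *: maj k.
  rewrite (bigD1 j) //= eqxx scale1r big1 ?addr0 // => k kj.
  by rewrite eq_sym (negbTE kj) scale0r.
rewrite -sumrB; apply: eq_bigr => k _; rewrite mxE scalerA -scalerBl.
by congr (_ *: _); rewrite !(rmorphB (real_complex R)) !(rmorphMn (real_complex R)) /=;
  rewrite !(rmorphM (real_complex R)) mulrnAl.
Qed.

Lemma gaussian_majorana m : gaussian (maj m).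
Proof.
rewrite (_ : maj m = vecmaj (fun k => (k == m)%:R)).
  apply: gaussian_vecmaj; rewrite (bigD1 m) //= eqxx expr1n big1 ?addr0 // => k km.
  by rewrite (negbTE km) expr0n.
rewrite /vecmaj (bigD1 m) //= eqxx scale1r big1 ?addr0 // => k km.
by rewrite (negbTE km) scale0r.
Qed.

Lemma gaussian_pair (m l : 'I_(2 * n)) (a b : R) : m != l -> a ^+ 2 + b ^+ 2 = 1 ->
  gaussian (a%:C *: maj m + b%:C *: maj l).
Proof.
move=> ml ab; have lm : l == m = false by rewrite eq_sym (negbTE ml).
rewrite (_ : _ + _ = vecmaj (fun k => if k == m then a else if k == l then b else 0)).
  apply: gaussian_vecmaj; rewrite (bigD1 m) //= eqxx (bigD1 l) /=; last by rewrite lm.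
  rewrite lm eqxx big1 ?addr0 // => k /andP[/negbTE -> /negbTE ->].
  by rewrite expr0n.
rewrite /vecmaj (bigD1 m) //= eqxx (bigD1 l) /=; last by rewrite lm.
rewrite lm eqxx big1 ?addr0 // => k /andP[/negbTE -> /negbTE ->].
by rewrite scale0r.
Qed.
End Gaussian.

(** * Two-qubit gates placed on two qubits of a register *)

Section Gates.
Variable R : realType.
Local Notation C := R[i].

Lemma ket2_inj (a b c d : 'I_2) : (ket2 a b == ket2 c d) = (a == c) && (b == d).
Proof. by rewrite /ket2 (can_eq (@mxtens_indexK 2 2)). Qed.

Section OneGate.
Variable n : nat.
Variables j k : 'I_n.
Hypothesis jk : j != k.

Lemma gate_atE (A : 'M[C]_(2 * 2)) x y : gate_at j k A x y =
  A (ket2 (bit x j) (bit x k)) (ket2 (bit y j) (bit y k)) *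
  \prod_(i < n | (i != j) && (i != k)) (bit x i == bit y i)%:R.
Proof.
rewrite mxE; congr (_ * _).
  by rewrite (eq_bigl (pred1 tt)) ?big_pred1_eq // => -[].
by apply: eq_bigl => i; apply/forallP/idP => [/(_ tt)|? []].
Qed.

Lemma gate_atD (A B : 'M[C]_(2 * 2)) : gate_at j k (A + B) = gate_at j k A + gate_at j k B.
Proof. by apply/matrixP => x y; rewrite [RHS]mxE !gate_atE mxE mulrDl. Qed.

Lemma gate_atZ z (A : 'M[C]_(2 * 2)) : gate_at j k (z *: A) = z *: gate_at j k A.
Proof. by apply/matrixP => x y; rewrite [RHS]mxE !gate_atE mxE mulrA. Qed.

Lemma gate_at_tens (A B : 'M[C]_2) : gate_at j k (A *t B) = on_qubit j A *m on_qubit k B.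
Proof.
rewrite qubit_tensorM; apply/matrixP => x y; rewrite gate_atE tensmxE [RHS]mxE.
rewrite [RHS](bigD1 j) //= [X in _ = _ * X](bigD1 k) 1?eq_sym //= mulrA.
rewrite /set_qubit !eqxx (negbTE jk) (eq_sym k) (negbTE jk) mulmx1 mul1mx; congr (_ * _).
by apply: eq_bigr => i /andP[/negbTE-> /negbTE->]; rewrite mulmx1 mxE.
Qed.
End OneGate.
End Gates.

(** * Gates *)

Section Gates.
Variable R : realType.
Local Notation C := R[i].

Lemma ord2_cases (P : 'I_2 -> Prop) : P 0 -> P 1 -> forall a, P a.
Proof.
move=> P0 P1 [[|[|//]] lt]; first by rewrite (_ : Ordinal lt = 0) //; apply/val_inj.
by rewrite (_ : Ordinal lt = 1) //; apply/val_inj.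
Qed.

Lemma ket2_eta (x : 'I_(2 * 2)) : x = ket2 (mxtens_unindex x).1 (mxtens_unindex x).2.
Proof. by rewrite /ket2 -surjective_pairing mxtens_unindexK. Qed.

Lemma mx4P (A B : 'M[C]_(2 * 2)) :
  (forall a b c d, A (ket2 a b) (ket2 c d) = B (ket2 a b) (ket2 c d)) -> A = B.
Proof. by move=> AB; apply/matrixP => x y; rewrite (ket2_eta x) (ket2_eta y). Qed.

Lemma SWAPE (a b c d : 'I_2) : @SWAP R (ket2 a b) (ket2 c d) = ((a == d) && (b == c))%:R.
Proof.
rewrite /SWAP /tperm_mx /perm_mx !mxE.
have -> : tperm (ket2 0 1) (ket2 1 0) (ket2 a b) = ket2 b a.
  by elim/ord2_cases: a; elim/ord2_cases: b; rewrite ?tpermL ?tpermR ?tpermD // ket2_inj.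
by rewrite ket2_inj andbC.
Qed.

Lemma fSWAP_pauli : @fSWAP R = 2^-1 *: (PZ *t 1%:M + 1%:M *t PZ + PX *t PX + PY *t PY).
Proof.
apply: mx4P => a b c d; rewrite [LHS]mxE SWAPE ket2_inj [RHS]mxE.
have sumE (A B : 'M[C]_(2 * 2)) x y : (A + B) x y = A x y + B x y by rewrite mxE.
rewrite !sumE /ket2 !tensmxE !mxE.
elim/ord2_cases: a; elim/ord2_cases: b; elim/ord2_cases: c; elim/ord2_cases: d => /=;
 rewrite ?mulrNN ?mulNr ?mulrN ?sqr_ii; by field.
Qed.

Section OneGate.
Variable n : nat.

Lemma mj_proof (j : 'I_n) (b : bool) : (b + j.*2 < 2 * n)%N.
Proof. by rewrite mul2n; case: b; rewrite ?ltn_Sdouble ?ltn_double. Qed.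
(** The Majorana index with X ([false]) or Y ([true]) on qubit [j]. *)
Definition mj j b : 'I_(2 * n) := Ordinal (mj_proof j b).

Lemma mj_half j b : (mj j b)./2 = j.
Proof. by rewrite /= half_bit_double. Qed.
Lemma mj_odd j b : odd (mj j b) = b.
Proof. by rewrite /= oddD odd_double addbF oddb. Qed.

Lemma mj_eq j b k c : (mj j b == mj k c) = (j == k) && (b == c).
Proof.
apply/eqP/andP => [e|[/eqP-> /eqP->]] //.
by split; apply/eqP; [apply/val_inj; rewrite /= -(mj_half j b) e mj_half|rewrite -(mj_odd j b) e mj_odd].
Qed.

Lemma majorana_mj j b : majorana (mj j b) = qubit_tensor (fun i : 'I_n =>
    if (i < j)%N then PZ else if i == j then (if b then @PY R else PX) else 1%:M).
Proof. by rewrite /majorana mj_half mj_odd. Qed.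

Lemma majorana_pair j : majorana (mj j false) *m majorana (mj j true) = ii *: on_qubit j (@PZ R).
Proof.
rewrite !majorana_mj qubit_tensorM -qubit_tensor_setZ; apply: eq_qubit_tensor => i.
rewrite /set_qubit -val_eqE /=; case: ltngtP => _; rewrite ?mulmx1 //; last exact: pauliXY.
by rewrite mx2M mx2_1; congr mx2; ring.
Qed.

Lemma on_qubit1 j : on_qubit j 1%:M = 1%:M :> 'M[C]_(qdim n).
Proof. by rewrite -qubit_tensor1; apply: eq_qubit_tensor => i; rewrite /set_qubit if_same. Qed.

Lemma on_qubit_mulC j k (A B : 'M[C]_2) : j != k ->
  on_qubit j A *m on_qubit k B = on_qubit k B *m on_qubit j A :> 'M[C]_(qdim n).
Proof.
move=> jk; rewrite !qubit_tensorM; apply: eq_qubit_tensor => i; rewrite /set_qubit.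
by case: eqVneq => [->|_]; rewrite ?(negbTE jk) ?mulmx1 ?mul1mx //; case: eqP; rewrite ?mulmx1 ?mul1mx.
Qed.

Lemma on_qubitZ_majorana j : on_qubit j (@PZ R) =
  - ii *: (majorana (mj j false) *m majorana (mj j true)).
Proof. by rewrite majorana_pair scalerA mulNr sqr_ii opprK scale1r. Qed.

Lemma gaussian_onZ (j : 'I_n) : gaussian (on_qubit j (@PZ R)).
Proof.
rewrite on_qubitZ_majorana; apply: gaussianZ; first by rewrite conj_Nii mulNr sqr_ii opprK.
by apply: gaussianM; apply: gaussian_majorana.
Qed.

Lemma gate_at_ZZ (j k : 'I_n) : j != k -> gate_at j k (@ZZ R) = on_qubit j PZ *m on_qubit k PZ.
Proof. by move=> jk; rewrite gate_at_tens. Qed.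

Lemma gaussian_ZZ (j k : 'I_n) : j != k -> gaussian (gate_at j k (@ZZ R)).
Proof. by move=> jk; rewrite gate_at_ZZ //; apply: gaussianM; apply: gaussian_onZ. Qed.

Lemma gate_at1 j k : j != k -> gate_at j k 1%:M = 1%:M :> 'M[C]_(qdim n).
Proof.
move=> jk; rewrite (_ : 1%:M = 1%:M *t 1%:M) ?gate_at_tens ?on_qubit1 ?mulmx1 //.
by apply: mx4P => a b c d; rewrite tensmxE !mxE ket2_inj -natrM mulnb.
Qed.

(** A product of two unit vectors: c_0^2 = 1 yields the cosine term and c_1 c_0 = -i Z the sine
    term. *)
Lemma rotation_Z (j : 'I_n) (x : R) :
  on_qubit j ((cos x)%:C *: 1%:M + (- ii * (sin x)%:C) *: @PZ R) =
  ((cos x)%:C *: majorana (mj j false) + (sin x)%:C *: majorana (mj j true))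
   *m majorana (mj j false).
Proof.
rewrite /on_qubit qubit_tensor_setD !qubit_tensor_setZ -!/(on_qubit j _) on_qubit1.
rewrite mulmxDl -!scalemxAl majorana_sq; congr (_ + _).
rewrite (@majorana_anti _ _ (mj j true)); last by rewrite mj_eq eqxx.
rewrite majorana_pair scalerN scalerA -scaleNr; congr (_ *: _).
by rewrite mulNr mulrC.
Qed.

Lemma gaussian_rotation_Z (j : 'I_n) (x : R) :
  gaussian (on_qubit j ((cos x)%:C *: 1%:M + (- ii * (sin x)%:C) *: @PZ R)).
Proof.
rewrite rotation_Z; apply: gaussianM; last exact: gaussian_majorana.
by apply: gaussian_pair; [rewrite mj_eq eqxx|rewrite cos2Dsin2].
Qed.

Lemma gate_fSWAP_pauli (j k : 'I_n) : j != k -> gate_at j k (@fSWAP R) =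
  2^-1 *: (on_qubit j PZ + on_qubit k PZ + on_qubit j PX *m on_qubit k PX
   + on_qubit j PY *m on_qubit k PY).
Proof.
by move=> jk; rewrite fSWAP_pauli gate_atZ !gate_atD !(gate_at_tens jk) !on_qubit1 mulmx1 mul1mx.
Qed.

Lemma gate_fSWAP_sym (j k : 'I_n) : j != k -> gate_at j k (@fSWAP R) = gate_at k j fSWAP.
Proof.
move=> jk; have kj : k != j by rewrite eq_sym.
rewrite (gate_fSWAP_pauli jk) (gate_fSWAP_pauli kj) (addrC (on_qubit k PZ) (on_qubit j PZ)).
by rewrite (@on_qubit_mulC k j PX PX kj) (@on_qubit_mulC k j PY PY kj).
Qed.

(** For consecutive qubits no Z string is left between the two, so XX and YY are phases times c_1
    c_2 and c_0 c_3, while the two Z are phases times c_0 c_1 and c_2 c_3. These four terms are the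
    expansion of (c_0 - c_2)(c_1 - c_3), and 1/sqrt 2 makes both vectors unit vectors. *)
Lemma gate_fSWAP_majorana (j k : 'I_n) : k = j.+1 :> nat ->
  gate_at j k (@fSWAP R) = - ii *:
   (((Num.sqrt 2)^-1%:C *: majorana (mj j false) + (- (Num.sqrt 2)^-1)%:C *: majorana (mj k false))
   *m ((Num.sqrt 2)^-1%:C *: majorana (mj j true) + (- (Num.sqrt 2)^-1)%:C *: majorana (mj k true))).
Proof.
move=> kj; have jk : j != k by rewrite -val_eqE /= kj neq_ltn ltnSn.
rewrite gate_fSWAP_pauli // !rmorphN !scaleNr -!scalerBr -scalemxAl -scalemxAr !scalerA.
set c0 := majorana (mj j false); set c1 := majorana (mj j true).
set c2 := majorana (mj k false); set c3 := majorana (mj k true).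
have -> : (c0 - c2) *m (c1 - c3) = c0 *m c1 + c2 *m c3 + c1 *m c2 - c0 *m c3.
  rewrite mulmxBl !mulmxBr (@majorana_anti _ _ (mj k false) (mj j true)) ?mj_eq ?andbF //.
  rewrite opprB opprK -/c1 -/c2; rewrite -!addrA; congr (_ + _).
  by rewrite addrC addrA addrC addrA.
rewrite !majorana_pair.
have PZ2 : @PZ R *m PZ = 1%:M by rewrite mx2M mx2_1; congr mx2; ring.
have -> : c1 *m c2 = ii *: (on_qubit j PX *m on_qubit k PX).
  rewrite /c1 /c2 !majorana_mj scalemxAl /on_qubit -qubit_tensor_setZ !qubit_tensorM.
  apply: eq_qubit_tensor => i; rewrite /set_qubit -!val_eqE /= kj ltnS.
  case: ltngtP => [ij|ij|ij]; first by rewrite (ltn_eqF (leqW ij)) PZ2 mulmx1.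
    by case: eqP; rewrite ?mul1mx.
  by rewrite ij (ltn_eqF (ltnSn j)) pauliYZ mulmx1.
have -> : c0 *m c3 = - ii *: (on_qubit j PY *m on_qubit k PY).
  rewrite /c0 /c3 !majorana_mj scalemxAl /on_qubit -qubit_tensor_setZ !qubit_tensorM.
  apply: eq_qubit_tensor => i; rewrite /set_qubit -!val_eqE /= kj ltnS.
  case: ltngtP => [ij|ij|ij]; first by rewrite (ltn_eqF (leqW ij)) PZ2 mulmx1.
    by case: eqP; rewrite ?mul1mx.
  by rewrite ij (ltn_eqF (ltnSn j)) pauliXZ mulmx1.
rewrite scaleNr opprK -!scalerDr scalerA -scaleNr.
set s := (_^-1)%:C; have s2 : s * s = 2^-1.
  by rewrite /s -rmorphM -invfM -expr2 sqr_sqrtr // fmorphV rmorph_nat.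
have -> : - (ii * s * s * ii) = - (ii * ii) * (s * s) by ring.
by rewrite sqr_ii s2 opprK mul1r.
Qed.

Lemma gaussian_fSWAP (j k : 'I_n) : neighbours j k -> gaussian (gate_at j k (@fSWAP R)).
Proof.
have s2 : (Num.sqrt 2)^-1 ^+ 2 + (- (Num.sqrt 2)^-1) ^+ 2 = 1 :> R.
  by rewrite sqrrN exprVn sqr_sqrtr //; field.
have main (j' k' : 'I_n) : k' = j'.+1 :> nat -> gaussian (gate_at j' k' (@fSWAP R)).
  move=> kj; have jk : j' != k' by rewrite -val_eqE /= kj neq_ltn ltnSn.
  rewrite gate_fSWAP_majorana //; apply: gaussianZ; first by rewrite conj_Nii mulNr sqr_ii opprK.
  by apply: gaussianM; apply: gaussian_pair; rewrite // mj_eq negb_and jk.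
case=> [/main//|kj]; rewrite gate_fSWAP_sym; first exact: main.
by rewrite -val_eqE /= kj neq_ltn ltnSn orbT.
Qed.
End OneGate.

End Gates.

(** * Exponentials of diagonal matrices and the rotation gates *)

Section Exponentials.
Variable R : realType.
Local Notation C := R[i].

Lemma cisD (x y : R) : cis (x + y) = cis x * cis y :> C.
Proof. by apply/eqP; rewrite eq_complex /= cosD sinD [_ + cos x * _]addrC !eqxx. Qed.

Lemma cis0 : cis 0 = 1 :> C.
Proof. by rewrite /cis cos0 sin0. Qed.

Lemma cisE (x : R) : cis x = (cos x)%:C + ii * (sin x)%:C.
Proof. by apply/eqP; rewrite eq_complex /= !(mul0r, mulr0, mul1r, subr0, addr0, add0r) !eqxx. Qed.

Lemma cisNE (x : R) : cis (- x) = (cos x)%:C - ii * (sin x)%:C.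
Proof. by rewrite cisE cosN sinN rmorphN mulrN. Qed.

Lemma cis_conj (x : R) : cis x * Num.conj (cis x) = 1.
Proof.
have -> : Num.conj (cis x) = cis (- x) by rewrite /cis cosN sinN.
by rewrite -cisD subrr cis0.
Qed.

Lemma diag_mxX m (d : 'rV[C]_m) k : diag_mx d ^+ k = diag_mx (\row_j d 0 j ^+ k).
Proof.
elim: k => [|k IH].
  by rewrite expr0; apply/matrixP => i j; rewrite !mxE.
rewrite exprS IH [LHS]mulmx_diag; congr diag_mx.
by apply/rowP => j; rewrite !mxE -exprS.
Qed.

(** Splitting [k] by parity turns the exponential series of i y into the cosine and sine series. *)
Lemma powii (y : R) k : (ii * y%:C) ^+ k / k`!%:R =
  cos_coeff y k +i* sin_coeff y k.
Proof.
have iX : (@ii R) ^+ k = ((~~ odd k)%:R * (-1) ^+ k./2) +i* ((odd k)%:R * (-1) ^+ k.-1./2).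
  rewrite -{1}(odd_double_half k) exprD -mul2n exprM expr2 sqr_ii.
  have -> : (-1 : C) ^+ k./2 = ((-1) ^+ k./2)%:C by rewrite rmorphXn rmorphN1.
  case: (boolP (odd k)) => ok; last first.
    by rewrite expr0 !mul1r mul0r.
  rewrite expr1 mul0r mul1r.
  have -> : k.-1./2 = k./2 by case: k ok => //= k ok; rewrite uphalf_half (negbTE ok).
  by apply/eqP; rewrite eq_complex /=; apply/andP; split; apply/eqP; ring.
rewrite exprMn iX -rmorphXn.
have -> : (k`!%:R : C)^-1 = (k`!%:R^-1)%:C by rewrite fmorphV rmorph_nat.
apply/eqP; rewrite eq_complex /cos_coeff /sin_coeff /=.
by apply/andP; split; apply/eqP; rewrite ?mulr0 ?subr0 ?addr0 ?mul0r ?add0r.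
Qed.

Lemma expmx_diag m (x : 'I_m -> R) :
  expmx (diag_mx (\row_j (ii * (x j)%:C))) = diag_mx (\row_j cis (x j)).
Proof.
apply/matrixP => a b; rewrite !mxE.
have e N : expmx_partial (diag_mx (\row_j (ii * (x j)%:C))) N a b =
    (series (cos_coeff (x a)) N +i* series (sin_coeff (x a)) N) *+ (a == b).
  rewrite /expmx_partial summxE.
  under eq_bigr => k _ do rewrite diag_mxX !mxE mulrnAr mulrC powii.
  rewrite sumrMnl; congr (_ *+ _); rewrite /series /= !big_mkord.
  elim/big_ind3: _ => // u1 u2 u3 v1 v2 v3 -> ->; by [].
have [ab|ab] := eqVneq a b; last first.
  rewrite mulr0n.
  rewrite (_ : (fun N => _) = fun=> 0); last by apply/funext => N; rewrite e (negbTE ab).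
  rewrite (_ : (fun N => complex.Im _) = fun=> 0); last by apply/funext => N; rewrite e (negbTE ab).
  by rewrite !lim_cst.
rewrite mulr1n (_ : (fun N => _) = series (cos_coeff (x a))); last first.
  by apply/funext => N; rewrite e ab eqxx.
rewrite (_ : (fun N => complex.Im _) = series (sin_coeff (x a))); last first.
  by apply/funext => N; rewrite e ab eqxx.
by rewrite /cis !unlock ab.
Qed.

Lemma PZ_diag : @PZ R = diag_mx (\row_j (if j == 0 then 1 else -1)).
Proof.
by apply/matrixP => i j; rewrite !mxE; elim/ord2_cases: i; elim/ord2_cases: j.
Qed.

Lemma RZE (phi : R) : RZ phi =
  (cos (phi / 2))%:C *: 1%:M + (- ii * (sin (phi / 2))%:C) *: PZ.
Proof.
rewrite /RZ (_ : _ *: PZ = diag_mx (\row_j (ii * (if j == 0 then - (phi / 2) else phi / 2)%:C))).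
  rewrite expmx_diag; apply/matrixP => i j; rewrite !mxE.
  elim/ord2_cases: i; elim/ord2_cases: j; rewrite /= ?mulr0 ?addr0 //.
    by rewrite cisNE !mulr1n !mulr1 mulNr.
  by rewrite cisE !mulr1n !mulr1 mulrN1 mulNr opprK.
apply/matrixP => i j; rewrite !mxE.
elim/ord2_cases: i; elim/ord2_cases: j; rewrite /= ?mulr0 //.
  by rewrite mulr1n mulr1 rmorphN mulNr mulrN.
by rewrite mulr1n mulrN1 mulNr opprK.
Qed.

Lemma addmxE m k (A B : 'M[C]_(m, k)) i j : (A + B) i j = A i j + B i j.
Proof. by rewrite mxE. Qed.
Lemma oppmxE m k (A : 'M[C]_(m, k)) i j : (- A) i j = - A i j.
Proof. by rewrite mxE. Qed.
Lemma scalemxE m k a (A : 'M[C]_(m, k)) i j : (a *: A) i j = a * A i j.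
Proof. by rewrite mxE. Qed.
Lemma scalar_mxE m (a : C) (i j : 'I_m) : a%:M i j = a *+ (i == j).
Proof. by rewrite mxE. Qed.

Lemma ZZ_ket (a b c d : 'I_2) : @ZZ R (ket2 a b) (ket2 c d) =
  (ket2 a b == ket2 c d)%:R * (if c == d then 1 else -1).
Proof.
rewrite /ZZ tensmxE !mxE ket2_inj.
by elim/ord2_cases: a; elim/ord2_cases: b; elim/ord2_cases: c; elim/ord2_cases: d => /=; ring.
Qed.

Lemma RZZE (phi : R) : RZZ phi =
  (cos (phi / 2))%:C *: 1%:M - (ii * (sin (phi / 2))%:C) *: ZZ.
Proof.
(* Z (x) Z has eigenvalue 1 on equal bits and -1 on different bits. *)
pose x (j : 'I_(2 * 2)) : R :=
  if (mxtens_unindex j).1 == (mxtens_unindex j).2 then - (phi / 2) else phi / 2.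
have xE c d : x (ket2 c d) = if c == d then - (phi / 2) else phi / 2.
  by rewrite /x /ket2 mxtens_indexK.
have -> : RZZ phi = expmx (diag_mx (\row_j (ii * (x j)%:C))).
  congr expmx; apply: mx4P => a b c d; rewrite [LHS]mxE ZZ_ket [RHS]mxE mxE xE ket2_inj.
  by case: andP => [[/eqP-> /eqP->]|_]; case: eqP => _;
    rewrite ?mulr1n ?mulr0n ?rmorphN; ring.
rewrite (expmx_diag x); apply: mx4P => a b c d.
rewrite [LHS]mxE mxE xE addmxE oppmxE !scalemxE ZZ_ket scalar_mxE ket2_inj.
by case: andP => [[/eqP-> /eqP->]|_]; case: eqP => _;
  rewrite ?cisNE ?cisE ?mulr1n ?mulr0n; ring.
Qed.
End Exponentials.

(** * Tensor products of two-qubit gates and their traces against Gaussian unitaries *)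

Section GateTensor.
Variable R : realType.
Local Notation C := R[i].
Variables (T : finType) (n : nat) (p q : T -> 'I_n).
Implicit Types G H : T -> 'M[C]_(2 * 2).

Local Notation idle i := [forall s, (i != p s) && (i != q s)].

Lemma eq_gate_tensor G H : G =1 H -> gate_tensor p q G = gate_tensor p q H.
Proof.
by move=> GH; apply/matrixP => x y; rewrite !mxE; congr (_ * _); apply: eq_bigr => s _; rewrite GH.
Qed.

Lemma gate_tensor_diag_neq H x y : (forall s, is_diag_mx (H s)) -> x != y ->
  gate_tensor p q H x y = 0.
Proof.
move=> dH xy; rewrite mxE.
have [i xyi] : exists i, bit x i != bit y i.
  by apply/existsP; apply: contraNT xy => /existsPn xy; apply/eqP/bit_inj => i;
    apply/eqP; have := xy i; rewrite negbK.
have [hi|] := boolP (idle i).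
  rewrite [X in _ * X](bigD1 i) /=; last exact: hi.
  by rewrite (negbTE xyi) mul0r mulr0.
rewrite negb_forall => /existsP[s]; rewrite negb_and !negbK => iss.
rewrite (bigD1 s) //= (is_diag_mxP (dH s)) ?mul0r //.
rewrite val_eqE ket2_inj negb_and.
by case/orP: iss => /eqP <-; rewrite xyi ?orbT.
Qed.

(** Diagonality of the right factor leaves a single intermediate basis state in the matrix product,
    so the entries multiply gate by gate. *)
Lemma gate_tensor_mul_diag G H : (forall s, is_diag_mx (H s)) ->
  gate_tensor p q G *m gate_tensor p q H = gate_tensor p q (fun s => G s *m H s).
Proof.
move=> dH; apply/matrixP => x y; rewrite [LHS]mxE (bigD1 y) //= big1 ?addr0; last first.
  by move=> z zy; rewrite (gate_tensor_diag_neq dH zy) mulr0.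
rewrite ![in LHS]mxE [X in _ * (_ * X)]big1 ?mulr1; last by move=> i _; rewrite eqxx.
rewrite mulrAC -big_split mxE; congr (_ * _); apply: eq_bigr => s _.
rewrite [RHS]mxE (bigD1 (ket2 (bit y (p s)) (bit y (q s)))) //= big1 ?addr0 // => z zy.
by rewrite (is_diag_mxP (dH s)) ?mulr0.
Qed.

Lemma gate_tensor1 : gate_tensor p q (fun _ => 1%:M) = 1%:M :> 'M[C]_(qdim n).
Proof.
apply/matrixP => x y; have [->|xy] := eqVneq x y; last first.
  by rewrite gate_tensor_diag_neq // mxE (negbTE xy).
rewrite !mxE !big1 ?mulr1 ?eqxx // => [i _|s _]; first by rewrite eqxx.
by rewrite mxE eqxx.
Qed.

Hypotheses (p_inj : injective p) (q_inj : injective q) (pq : forall r s, p r != q s).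

Definition replace s (x y : 'I_(qdim n)) : 'I_(qdim n) :=
  enum_rank [ffun i => if (i == p s) || (i == q s) then bit x i else bit y i].

Lemma bit_replace s x y i : bit (replace s x y) i =
  if (i == p s) || (i == q s) then bit x i else bit y i.
Proof. by rewrite /bit enum_rankK ffunE. Qed.

(** Only the basis state [replace s x y] contributes to the matrix product: the identity at [s]
    forces agreement with [x] on the two qubits of [s], and the single gate forces agreement with
    [y] elsewhere. *)
Lemma gate_tensor_split G H s :
  G s = 1%:M -> (forall r, r != s -> G r = H r) ->
  gate_tensor p q H = gate_tensor p q G *m gate_at (p s) (q s) (H s).
Proof.
move=> Gs GH; apply/matrixP => x y; rewrite [RHS]mxE (bigD1 (replace s x y)) //= big1 => [|z zr].
  rewrite addr0 gate_atE !bit_replace !eqxx orbT /= [X in _ * (_ * X)]big1; last first.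
    by move=> i /andP[/negbTE ip /negbTE iq]; rewrite bit_replace ip iq eqxx.
  rewrite mulr1 !mxE mulrAC; congr (_ * _).
    rewrite (bigD1 s) //= [in RHS](bigD1 s) //= Gs !bit_replace !eqxx orbT mxE eqxx mul1r mulrC.
    congr (_ * _); apply: eq_bigr => r rs; rewrite GH // !bit_replace.
    rewrite !(inj_eq p_inj) !(inj_eq q_inj) (negbTE rs) (negbTE (pq _ _)).
    by rewrite eq_sym (negbTE (pq _ _)).
  apply: eq_bigr => i /forallP/(_ s)/andP[/negbTE ip /negbTE iq].
  by rewrite bit_replace ip iq.
have [i zi] : exists i, bit z i != bit (replace s x y) i.
  by apply/existsP; apply: contraNT zr => /existsPn zr; apply/eqP/bit_inj => i;
    apply/eqP; have := zr i; rewrite negbK.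
move: zi; rewrite bit_replace; case: ifP => [ipq|ipq] zi.
  rewrite mxE (bigD1 s) //= Gs mxE ket2_inj -!mulrA.
  suff -> : (bit x (p s) == bit z (p s)) && (bit x (q s) == bit z (q s)) = false by rewrite mul0r.
  by case/orP: ipq zi => /eqP <- zi; rewrite [bit x i == _]eq_sym (negbTE zi) ?andbF.
rewrite gate_atE [X in _ * (_ * X)](bigD1 i) /=; last by rewrite -negb_or ipq.
by rewrite (negbTE zi) mul0r !mulr0.
Qed.

Lemma gate_tensor_rprod G :
  gate_tensor p q G = rprod (fun s => gate_at (p s) (q s) (G s)) (enum T).
Proof.
(* Induction over the gates already included, the others being replaced by the identity. *)
have : forall L : seq T, uniq L -> gate_tensor p q (fun s => if s \in L then G s else 1%:M)
    = rprod (fun s => gate_at (p s) (q s) (G s)) L.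
  elim=> [_|s L IH /= /andP[sL uL]].
    by rewrite /= -gate_tensor1; apply: eq_gate_tensor => s.
  rewrite -IH // (gate_tensor_split (s := s) (G := fun r => if r \in L then G r else 1%:M)).
  - by rewrite mem_head.
  - by rewrite (negbTE sL).
  - by move=> r rs; rewrite inE (negbTE rs).
move=> /(_ (enum T) (enum_uniq T)) <-; apply: eq_gate_tensor => s.
by rewrite mem_enum.
Qed.

Lemma gaussian_gate_tensor G : (forall s, gaussian (gate_at (p s) (q s) (G s))) ->
  gaussian (gate_tensor p q G).
Proof.
move=> gG; rewrite gate_tensor_rprod; elim: (enum T) => [|s L IH] /=; first exact: gaussian1.
exact: gaussianM.
Qed.

Lemma on_qubitM j (A B : 'M[C]_2) : on_qubit j A *m on_qubit j B =
  on_qubit j (A *m B) :> 'M[C]_(qdim n).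
Proof.
rewrite qubit_tensorM; apply: eq_qubit_tensor => i; rewrite /set_qubit.
by case: eqP => // _; rewrite mulmx1.
Qed.

Lemma on_qubitZ_adj j : (on_qubit j (@PZ R))^t* = on_qubit j PZ :> 'M[C]_(qdim n).
Proof.
rewrite on_qubitZ_majorana trmxCZ trmxCM !majorana_adj conj_Nii.
rewrite (@majorana_anti _ _ (mj j true)); last by rewrite mj_eq eqxx.
by rewrite scalerN scaleNr.
Qed.

Definition Qgate s : 'M[C]_(qdim n) := gate_at (p s) (q s) (@ZZ R).

Definition zz_mx (a b : C) : 'M[C]_(2 * 2) := a *: 1%:M + b *: ZZ.

Lemma gate_zz_mx a b : gate_tensor p q (fun _ => zz_mx a b) =
  rprod (fun s => a *: 1%:M + b *: Qgate s) (enum T).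
Proof.
rewrite gate_tensor_rprod; elim: (enum T) => //= s L ->; congr (_ *m _).
by rewrite gate_atD !gate_atZ gate_at1.
Qed.

Lemma Qgate_majorana s : Qgate s = -1 *: (majorana (mj (p s) false) *m majorana (mj (p s) true)
  *m majorana (mj (q s) false) *m majorana (mj (q s) true)).
Proof.
rewrite /Qgate gate_at_ZZ ?pq // !on_qubitZ_majorana -scalemxAl -scalemxAr scalerA.
by rewrite mulrNN sqr_ii !mulmxA.
Qed.

Lemma qdim_gt0 : (0 < qdim n)%N.
Proof. by rewrite qdimE expn_gt0. Qed.

Lemma Qgate_adj s : (Qgate s)^t* = Qgate s.
Proof.
rewrite /Qgate gate_at_ZZ ?pq // trmxCM !on_qubitZ_adj; apply: on_qubit_mulC.
by rewrite eq_sym pq.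
Qed.

(** Only the identity term of the expansion has a trace: X on the qubit [p s] anticommutes with
    [Qgate s] and commutes with the other factors, so a term containing [Qgate s] has a trace equal
    to its negative. *)
Lemma ntr_zz_mx (a b : C) : ntr (gate_tensor p q (fun _ => zz_mx a b)) = a ^+ #|T|.
Proof.
rewrite gate_zz_mx cardE; have := enum_uniq T; elim: (enum T) => [|s L IH] /= => [_|/andP[sL uL]].
  by rewrite ntr1 ?qdim_gt0.
rewrite mulmxDr ntrD -scalemxAr mulmx1 ntrZ {}IH // -exprS -scalemxAr ntrZ.
suff -> : ntr (rprod (fun s => a *: 1%:M + b *: Qgate s) L *m Qgate s) = 0 by rewrite mulr0 addr0.
pose X := on_qubit (p s) (@PX R).
have X2 : X *m X = 1%:M.
  rewrite /X on_qubitM -[RHS](on_qubit1 R (p s)); congr on_qubit.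
  by rewrite mx2M mx2_1; congr mx2; ring.
have Xs : X *m Qgate s = - (Qgate s *m X).
  rewrite /Qgate gate_at_ZZ ?pq // -mulmxA [on_qubit (q s) _ *m X]on_qubit_mulC 1?eq_sym ?pq //.
  rewrite !mulmxA -mulNmx; congr (_ *m _).
  rewrite !on_qubitM pauliXZ pauliZX /on_qubit !qubit_tensor_setZ.
  exact: scaleNr.
have Xr r : r != s -> X *m Qgate r = Qgate r *m X.
  move=> rs; rewrite /Qgate gate_at_ZZ ?pq // -mulmxA [on_qubit (q r) _ *m X]on_qubit_mulC 1?eq_sym ?pq //.
  rewrite !mulmxA [X *m _]on_qubit_mulC // (inj_eq p_inj) eq_sym //.
have XL : X *m rprod (fun s => a *: 1%:M + b *: Qgate s) L =
    rprod (fun s => a *: 1%:M + b *: Qgate s) L *m X.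
  elim: L sL {uL} => [|r L IH] /=; first by rewrite mulmx1 mul1mx.
  rewrite inE negb_or eq_sym => /andP[rs sL]; rewrite mulmxA IH // -!mulmxA; congr (_ *m _).
  by rewrite mulmxDr mulmxDl -!scalemxAr -!scalemxAl mulmx1 mul1mx Xr.
set W := rprod _ L; set t := ntr _; suff : t = - t.
  by move/eqP; rewrite -addr_eq0 -mulr2n mulrn_eq0 /= => /eqP.
rewrite {1}/t -[W *m _]mulmx1 -X2 mulmxA ntrC !mulmxA XL -!mulmxA (mulmxA X) Xs.
by rewrite mulNmx -mulmxA X2 mulmx1 mulmxN ntrN.
Qed.

(** Instance of [rprod_norm_le1] whose blocks are the four Majorana indices on the qubits [p s] and
    [q s]; disjoint pairs of qubits give disjoint blocks. *)
Lemma ntr_gaussian_le1 (w : C) K : `|w| = 1 -> gaussian K ->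
  `|ntr (gate_tensor p q (fun _ => zz_mx 1 w) *m K)| <= 1.
Proof.
move=> w1 gK; have [S [SS KS]] := gaussian_comm gK.
rewrite gate_zz_mx.
pose b0 s := mj (p s) false; pose b1 s := mj (p s) true.
pose b2 s := mj (q s) false; pose b3 s := mj (q s) true.
have QE s : Qgate s =
    -1 *: (majorana (b0 s) *m majorana (b1 s) *m majorana (b2 s) *m majorana (b3 s)).
  exact: Qgate_majorana.
have b_uniq s : uniq [:: b0 s; b1 s; b2 s; b3 s].
  by rewrite /= !inE /b0 /b1 /b2 /b3 !mj_eq !eqxx !(negbTE (pq _ _)).
have disj : pairwise (fun s r =>
    [disjoint [set b0 s; b1 s; b2 s; b3 s] & [set b0 r; b1 r; b2 r; b3 r]]) (enum T).
  have := enum_uniq T; rewrite uniq_pairwise; apply: sub_pairwise => s r /= sr.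
  rewrite -setI_eq0; apply/eqP/setP => i; rewrite !inE.
  apply/negP => /andP[]; rewrite -!orbA => /or4P is1 /or4P is2.
  have nb (x y : 'I_n) b c : x != y -> mj x b != mj y c by move=> xy; rewrite mj_eq (negbTE xy).
  have pp : p s != p r by rewrite (inj_eq p_inj).
  have qq : q s != q r by rewrite (inj_eq q_inj).
  have qp : q s != p r by rewrite eq_sym pq.
  by case: is1 is2 => /eqP-> []; apply/negP; apply: nb; rewrite // pq.
have -> : rprod (fun s => 1 *: 1%:M + w *: Qgate s) (enum T) =
  rprod (fun s => 1%:M + w *: (-1 *: (majorana (b0 s) *m majorana (b1 s)
    *m majorana (b2 s) *m majorana (b3 s)))) (enum T).
  by elim: (enum T) => //= s L ->; rewrite scale1r QE.
apply: (rprod_norm_le1 qdim_gt0 (@majorana_adj R n) (@majorana_sq R n)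
  (@majorana_anti R n) b_uniq _ _ _ (gaussian_unitary gK) SS KS disj).
- by move=> s; rewrite normrN1.
- by [].
- by move=> s; rewrite -QE Qgate_adj.
Qed.
End GateTensor.

(** * The extent *)

Section Extent.
Variable R : realType.
Local Notation C := R[i].
Local Notation normc := ComplexField.Normc.normc.

Lemma normcCE (z : C) : (normc z)%:C = `|z|.
Proof. by []. Qed.

Lemma l1normCE (I : finType) (c : I -> C) : (l1norm c)%:C = \sum_i `|c i|.
Proof. by rewrite /l1norm rmorph_sum. Qed.

Lemma l1norm_ge_dual n (W U : 'M[C]_(qdim n)) (v : R) (I : finType) c
    (K : I -> 'M[C]_(qdim n)) :
  (forall V, gaussian V -> `|ntr (W *m V)| <= 1) -> v%:C <= `|ntr (W *m U)| ->
  decomposition c K U -> v <= l1norm c.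
Proof.
move=> W1 WU [gK UE]; rewrite -lecR; apply: le_trans WU _; rewrite UE.
rewrite mulmx_sumr ntr_sum; apply: le_trans (ler_norm_sum _ _ _) _.
rewrite l1normCE; apply: ler_sum => i _.
by rewrite -scalemxAr ntrZ normrM ler_piMr // W1.
Qed.

Lemma xi_of_decomposition n (U : 'M[C]_(qdim n)) (I : finType) c
    (K : I -> 'M[C]_(qdim n)) (v : R) :
  0 <= v -> decomposition c K U -> l1norm c = v ->
  (forall chi (c' : 'I_chi -> C) K', decomposition c' K' U -> v <= l1norm c') ->
  xi U = v ^+ 2.
Proof.
move=> v0 [gK UE] cv vle.
have in_v : extent_values U (v ^+ 2).
  (* The extent ranges over ordinal index types, so the terms are renumbered. *)
  exists #|I|, (fun i => c (enum_val i)), (fun i => K (enum_val i)).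
  rewrite -cv; split; first split=> [i|//]; first exact: gK.
    by rewrite UE (reindex_onto enum_val enum_rank) /= => [|i _];
       rewrite ?enum_rankK //; apply: eq_bigl => i; rewrite enum_valK eqxx.
  congr (_ ^+ 2); rewrite /l1norm (reindex_onto enum_val enum_rank) /= => [|i _];
       rewrite ?enum_rankK //; apply: eq_bigl => i; rewrite enum_valK eqxx //.
have lb : lbound (extent_values U) (v ^+ 2).
  move=> r [chi [c' [K' [dK ->]]]].
  have := vle _ _ _ dK => v_le.
  by rewrite lerXn2r // nnegrE // (le_trans v0).
apply/eqP; rewrite eq_le; apply/andP; split.
  by apply: ge_inf => //; exists (v ^+ 2).
by apply: lb_le_inf => //; exists (v ^+ 2).
Qed.

Lemma zz_mxE (x y : C) (a b c d : 'I_2) : zz_mx x y (ket2 a b) (ket2 c d) =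
  (ket2 a b == ket2 c d)%:R * (if c == d then x + y else x - y).
Proof.
rewrite addmxE !scalemxE ZZ_ket scalar_mxE.
by case: (c == d); case: eqP => _; rewrite ?mulr1n ?mulr0n; ring.
Qed.

Lemma zz_mx_diag (x y : C) : is_diag_mx (zz_mx x y : 'M[C]_(2 * 2)).
Proof.
apply/is_diag_mxP => i j; rewrite val_eqE (ket2_eta i) (ket2_eta j) zz_mxE => /negbTE ->.
by rewrite mul0r.
Qed.

Lemma ZZ_sq : @ZZ R *m ZZ = 1%:M.
Proof.
rewrite /ZZ tensmx_mul; have -> : @PZ R *m PZ = 1%:M by rewrite mx2M mx2_1; congr mx2; ring.
by apply: mx4P => a b c d; rewrite tensmxE !mxE ket2_inj -natrM mulnb.
Qed.

Lemma zz_mxM (x y x' y' : C) : zz_mx x y *m zz_mx x' y' =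
  zz_mx (x * x' + y * y') (x * y' + y * x').
Proof.
rewrite /zz_mx mulmxDl !mulmxDr -!scalemxAl -!scalemxAr ZZ_sq !mulmx1 mul1mx !scalerA !scalerDl.
by rewrite [X in _ + X]addrC addrACA.
Qed.

(** Comparing squares, the sign turns the cross term 2ab into 2|ab|. *)
Lemma norm_add_sign (a b : R) :
  `|a + (if 0 <= a * b then 1 else -1) * b| = `|a| + `|b|.
Proof.
rewrite -[RHS]ger0_norm ?addr_ge0 //; apply/eqP; rewrite -(@eqrXn2 _ 2) // !real_normK ?num_real //.
rewrite !sqrrD !real_normK ?num_real // -normrM exprMn.
by case: (leP 0 (a * b)) => ab; [rewrite (ger0_norm ab)|rewrite (ltr0_norm ab)]; apply/eqP; ring.
Qed.

Lemma ntr_unitary_conj d (F G W D : 'M[C]_d) :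
  F \is unitarymx -> G \is unitarymx ->
  ntr (G^t* *m W *m F^t* *m (F *m D *m G)) = ntr (W *m D).
Proof.
move=> FU GU; rewrite !mulmxA -[_ *m F^t* *m F]mulmxA (unitarymxPl FU) mulmx1 ntrC !mulmxA.
by move/unitarymxP: GU => ->; rewrite mul1mx.
Qed.

Lemma l1norm_lower_bound (T : finType) n (p q : T -> 'I_n) (a b : R)
    (F G : 'M[C]_(qdim n)) (I : finType) c (K : I -> 'M[C]_(qdim n)) :
  injective p -> injective q -> (forall r s, p r != q s) ->
  gaussian F -> gaussian G ->
  decomposition c K (F *m gate_tensor p q (fun _ => zz_mx a%:C (ii * b%:C)) *m G) ->
  (`|a| + `|b|) ^+ #|T| <= l1norm c.
Proof.
move=> p_inj q_inj pq gF gG.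
(* Duality: the witness is the product of the 1 + w Z(x)Z, the phase of w     *)
(* being chosen such that its overlap with each factor is |a| + |b|.          *)
pose sg : R := if 0 <= a * b then 1 else -1.
pose w : C := - ii * sg%:C.
have w1 : `|w| = 1.
  have ni : `|ii : C| = 1 by exact: normCi.
  rewrite normrM normrN ni mul1r /sg; case: ifP => _; first by rewrite normr1.
  by rewrite rmorphN1 normrN1.
pose W := gate_tensor p q (fun _ => zz_mx 1 w).
apply: (@l1norm_ge_dual _ (G^t* *m W *m F^t*)) => [V gV|].
  (* Cyclicity of the trace moves the adjoints of [F] and [G] onto [V], and the product stays
     Gaussian. *)
  rewrite -!mulmxA ntrC -!mulmxA; apply: ntr_gaussian_le1 => //.
  by rewrite mulmxA; apply: gaussianM; first apply: gaussianM => //; apply: gaussian_adj.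
have -> : ntr (G^t* *m W *m F^t* *m
    (F *m gate_tensor p q (fun _ => zz_mx a%:C (ii * b%:C)) *m G)) =
  ntr (W *m gate_tensor p q (fun _ => zz_mx a%:C (ii * b%:C))).
  by apply: ntr_unitary_conj; apply: gaussian_unitary.
rewrite gate_tensor_mul_diag; last by move=> s; apply: zz_mx_diag.
(* As [w] is -i times the sign, the identity coefficient a + w (i b) is a plus or minus b; its power
   is the trace. *)
have -> : zz_mx 1 w *m zz_mx a%:C (ii * b%:C) =
    zz_mx (a%:C + sg%:C * b%:C) (ii * b%:C + w * a%:C).
  rewrite zz_mxM !mul1r; congr (zz_mx (_ + _) _).
  by rewrite /w mulrACA mulNr sqr_ii opprK mul1r.
rewrite ntr_zz_mx // normrX -rmorphM -rmorphD.
have -> : `|(a + sg * b)%:C| = (`|a| + `|b|)%:C.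
  rewrite -normcCE /= expr0n addr0 sqrtr_sqr; congr (_%:C).
  exact: norm_add_sign.
by rewrite -rmorphXn.
Qed.

(** * Optimality for gates of the form F (a + i b Z(x)Z) G and their tensor powers *)

Section TwoTermGates.
Variables (U : 'M[C]_(2 * 2)) (c : bool -> C) (K : bool -> 'M[C]_(2 * 2)).
Variables (a b : R) (F G : 'M[C]_(2 * 2)).
Hypothesis U_sum : U = \sum_e c e *: K e.
Hypothesis U_prod : U = F *m zz_mx a%:C (ii * b%:C) *m G.
Hypothesis G_diag : is_diag_mx G.
Hypothesis c_norm : l1norm c = `|a| + `|b|.

Definition gaussian_factors n (j k : 'I_n) := [/\ forall e, gaussian (gate_at j k (K e)),
  gaussian (gate_at j k F) & gaussian (gate_at j k G)].

Lemma gate_tensor_lower_bound (T : finType) n (p q : T -> 'I_n) (I : finType) c'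
    (K' : I -> 'M[C]_(qdim n)) :
  injective p -> injective q -> (forall r s, p r != q s) ->
  (forall s, gaussian_factors (p s) (q s)) ->
  decomposition c' K' (gate_tensor p q (fun _ => U)) -> l1norm c ^+ #|T| <= l1norm c'.
Proof.
move=> p_inj q_inj pq gd; rewrite c_norm U_prod.
(* The right and middle factors are diagonal, so the tensor power splits into a product of three
   tensor powers, the outer two Gaussian. *)
rewrite -(@gate_tensor_mul_diag _ _ _ _ _ (fun=> F *m zz_mx a%:C (ii * b%:C)) (fun=> G)) //.
rewrite -(@gate_tensor_mul_diag _ _ _ _ _ (fun=> F) (fun=> zz_mx a%:C (ii * b%:C))); last first.
  by move=> s; apply: zz_mx_diag.
by apply: l1norm_lower_bound => //; apply: gaussian_gate_tensor => // s; case: (gd s).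
Qed.

Lemma l1norm_ge0 (I : finType) (d : I -> C) : 0 <= l1norm d.
Proof. by apply: sumr_ge0 => i _; rewrite -ler0c normcCE normr_ge0. Qed.

Lemma optimal_gate_at n (j k : 'I_n) : j != k -> gaussian_factors j k ->
  xi (gate_at j k U) = l1norm c ^+ 2 /\
  optimal c (fun e => gate_at j k (K e)) (gate_at j k U).
Proof.
move=> jk gd; have dec : decomposition c (fun e => gate_at j k (K e)) (gate_at j k U).
  split=> [e|]; first by case: gd.
  by rewrite U_sum !big_bool gate_atD !gate_atZ.
suff xiE : xi (gate_at j k U) = l1norm c ^+ 2 by split.
apply: xi_of_decomposition dec _ _ => // [|chi c' K' dec']; first exact: l1norm_ge0.
(* A single gate is a tensor product indexed by [unit]. *)
rewrite -[leLHS]expr1 -card_unit.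
by apply: (@gate_tensor_lower_bound unit n (fun=> j) (fun=> k)) dec' => // -[] [].
Qed.

(** The l1 norm is multiplicative over independent choices of terms, and so is the dual lower bound;
    hence the two still match. *)
Lemma optimal_tensor_power t n (p q : 'I_t -> 'I_n) : disjoint_pairs p q ->
  (forall s, gaussian_factors (p s) (q s)) ->
  xi (tensor_power p q U) = (l1norm c ^+ 2) ^+ t /\
  optimal (tensor_coef c) (tensor_term p q K) (tensor_power p q U).
Proof.
move=> [p_inj q_inj pq] gd.
have cE : l1norm (@tensor_coef R t c) = l1norm c ^+ t.
  apply: complexI; rewrite (rmorphXn (real_complex R)) /= !l1normCE.
  have <- : \prod_(s < t) \sum_e `|c e| = (\sum_e `|c e|) ^+ t by rewrite prodr_const card_ord.
  rewrite bigA_distr_bigA; apply: eq_bigr => e _; exact: normr_prod.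
have dec : decomposition (tensor_coef c) (tensor_term p q K) (tensor_power p q U).
  split=> [e|]; first by apply: gaussian_gate_tensor => // s; case: (gd s).
  apply/matrixP => x y; rewrite summxE mxE.
  have UE u v : U u v = \sum_e c e * K e u v.
    by rewrite U_sum summxE; apply: eq_bigr => e _; rewrite mxE.
  rewrite [X in X * _](eq_bigr _ (fun s _ => UE _ _)).
  rewrite bigA_distr_bigA mulr_suml; apply: eq_bigr => e _.
  by rewrite [RHS]mxE [X in _ = _ * X]mxE mulrA -big_split.
suff xiE : xi (tensor_power p q U) = (l1norm c ^+ t) ^+ 2.
  by split; [rewrite xiE exprAC|split; rewrite // cE].
apply: xi_of_decomposition dec cE _ => [|chi c' K' dec'].
  by rewrite exprn_ge0 // l1norm_ge0.
by rewrite -[X in _ ^+ X]card_ord; apply: gate_tensor_lower_bound dec'.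
Qed.
End TwoTermGates.

Lemma gaussian_gate_RZ n (j k : 'I_n) (phi : R) : j != k ->
  gaussian (gate_at j k (RZ phi *t RZ phi)).
Proof.
by move=> jk; rewrite gate_at_tens // RZE; apply: gaussianM; apply: gaussian_rotation_Z.
Qed.

Lemma gate_at_mul_diag n (j k : 'I_n) (A B : 'M[C]_(2 * 2)) : is_diag_mx B ->
  gate_at j k (A *m B) = gate_at j k A *m gate_at j k B.
Proof. by move=> dB; rewrite [RHS]gate_tensor_mul_diag. Qed.

Lemma RZ_diag (phi : R) : is_diag_mx (RZ phi).
Proof.
rewrite RZE; apply/is_diag_mxP => i j.
by elim/ord2_cases: i; elim/ord2_cases: j; rewrite // !mxE /= !mulr0 addr0.
Qed.

Lemma tens_diag (A B : 'M[C]_2) : is_diag_mx A -> is_diag_mx B -> is_diag_mx (A *t B).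
Proof.
move=> /is_diag_mxP dA /is_diag_mxP dB; apply/is_diag_mxP => i j.
rewrite val_eqE (ket2_eta i) (ket2_eta j) ket2_inj negb_and tensmxE.
by case/orP => [/dA|/dB] ->; rewrite ?mul0r ?mulr0.
Qed.

Lemma two_ZZ_diag e : is_diag_mx (two (1%:M : 'M[C]_(2 * 2)) ZZ e).
Proof.
case: e; last exact: scalar_mx_is_diag.
by apply: tens_diag; rewrite PZ_diag diag_mx_is_diag.
Qed.

Lemma gaussian_two_ZZ n (j k : 'I_n) e : j != k ->
  gaussian (gate_at j k (two (1%:M : 'M[C]_(2 * 2)) ZZ e)).
Proof.
by move=> jk; case: e; [apply: gaussian_ZZ|rewrite gate_at1 //; apply: gaussian1].
Qed.

Lemma norm_cos_sin_sq (x : R) : (`|cos x| + `|sin x|) ^+ 2 = 1 + `|sin (x *+ 2)|.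
Proof.
rewrite sqrrD !real_normK ?num_real // addrAC cos2Dsin2 sin_mulr2n normrMn normrM.
by [].
Qed.

Lemma norm_cis (x : R) : normc (cis x) = 1.
Proof. by rewrite /= cos2Dsin2 sqrtr1. Qed.
Lemma norm_ii : normc (@ii R) = 1.
Proof. by rewrite /= expr0n add0r expr1n sqrtr1. Qed.
Lemma norm_real (x : R) : normc (x%:C) = `|x|.
Proof. by rewrite /= expr0n addr0 sqrtr_sqr. Qed.

End Extent.

(** * The controlled-phase, ZZ-rotation and SWAP gates *)

Section ConcreteGates.
Variable R : realType.
Local Notation C := R[i].
Local Notation normc := ComplexField.Normc.normc.
Local Notation RZ2 phi := (@RZ R phi *t RZ phi).

Lemma mulmx_diagE m (A B : 'M[C]_m) i j : is_diag_mx B -> (A *m B) i j = A i j * B j j.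
Proof.
move=> /is_diag_mxP dB; rewrite mxE (bigD1 j) //= big1 ?addr0 // => k kj.
by rewrite dB ?mulr0.
Qed.

Lemma RZ2_diag phi : is_diag_mx (RZ2 phi).
Proof. by apply: tens_diag; apply: RZ_diag. Qed.

Lemma RZ_entry (phi : R) a c : RZ phi a c =
  (a == c)%:R * (if c == 0 then cis (- (phi / 2)) else cis (phi / 2)).
Proof.
rewrite RZE addmxE !scalemxE scalar_mxE cisNE cisE mxE.
by elim/ord2_cases: a; elim/ord2_cases: c; rewrite /= ?mulr1n ?mulr0n; ring.
Qed.

Lemma zz_mx_RZ2 (x y : C) phi :
  zz_mx x y *m RZ2 phi = x *: (1%:M *m RZ2 phi) + y *: (ZZ *m RZ2 phi).
Proof. by rewrite /zz_mx mulmxDl -!scalemxAl. Qed.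

Lemma CPhase_entry (phi : R) (a b c d : 'I_2) : CPhase phi (ket2 a b) (ket2 c d) =
  (ket2 a b == ket2 c d)%:R * (if (c == 1) && (d == 1) then cis phi else 1).
Proof.
rewrite !mxE; have [->|_] := eqVneq (ket2 a b) (ket2 c d); last by rewrite mulr0n mul0r.
by rewrite mulr1n mul1r; elim/ord2_cases: c; elim/ord2_cases: d.
Qed.

Lemma CPhase_zz (phi : R) : CPhase phi = cis (phi / 4) *:
  (zz_mx (cos (phi / 4))%:C (ii * (sin (phi / 4))%:C) *m RZ2 (phi / 2)).
Proof.
apply: mx4P => a b c d; rewrite scalemxE mulmx_diagE ?RZ2_diag // zz_mxE -cisE -cisNE.
rewrite CPhase_entry tensmxE !RZ_entry !eqxx !mul1r.
have -> : phi / 2 / 2 = phi / 4 by field.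
(* All diagonal entries are products of u = e^(i theta/4) and its inverse; three of them cancel to 1
   and the last is u^4. *)
move: (ket2 a b == _)%:R => E; set x := phi / 4; set u := cis x; set v := cis (- x).
have uv : u * v = 1 by rewrite -cisD subrr cis0.
elim/ord2_cases: c; elim/ord2_cases: d => /=; rewrite ?mulr1.
- have -> : u * (E * u * (v * v)) = E * (u * v) * (u * v) by ring.
  by rewrite uv !mulr1.
- have -> : u * (E * v * (v * u)) = E * (u * v) * (u * v) by ring.
  by rewrite uv !mulr1.
- have -> : u * (E * v * (u * v)) = E * (u * v) * (u * v) by ring.
  by rewrite uv !mulr1.
have -> : phi = x + x + (x + x) by rewrite /x; field.
by rewrite !cisD -/u; ring.
Qed.

Lemma cos_pi4 : cos (pi / 4) = (Num.sqrt 2)^-1 :> R.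
Proof.
have c0 : 0 <= cos (pi / 4 : R).
  by rewrite cos_ge0_pihalf //; have := pi_gt0 R; lra.
have c2 : cos (pi / 4 : R) ^+ 2 = 2^-1.
  have := cos_mulr2n (pi / 4 : R); have -> : pi / 4 *+ 2 = pi / 2 :> R by field.
  by rewrite cos_pihalf; lra.
by rewrite -(ger0_norm c0) -sqrtr_sqr c2 sqrtrV.
Qed.

Lemma sin_pi4 : sin (pi / 4) = (Num.sqrt 2)^-1 :> R.
Proof.
have s0 : 0 <= sin (pi / 4 : R).
  by rewrite sin_ge0_pi //; have := pi_gt0 R; lra.
have s2 : sin (pi / 4 : R) ^+ 2 = 2^-1.
  by rewrite sin2cos2 cos_pi4 exprVn sqr_sqrtr //; field.
by rewrite -(ger0_norm s0) -sqrtr_sqr s2 sqrtrV.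
Qed.

(** The controlled phase at pi undoes the sign of fSWAP on the basis state 11. *)
Lemma SWAP_CPhase : @SWAP R = fSWAP *m CPhase pi.
Proof.
have dC : is_diag_mx (@CPhase R pi) by exact: diag_mx_is_diag.
apply: mx4P => a b c d; rewrite mulmx_diagE // CPhase_entry eqxx mul1r [fSWAP _ _]mxE ket2_inj.
rewrite /cis cospi sinpi; case: ifP => _; last by rewrite mul1r mulr1.
have -> : (-1 +i* 0 : C) = -1 by apply/eqP; rewrite eq_complex /= oppr0 !eqxx.
by rewrite mulN1r mulrN1 opprK.
Qed.

Lemma SWAP_zz : @SWAP R = (cis (pi / 4) / (Num.sqrt 2)%:C) *:
  (fSWAP *m (1%:M + ii *: ZZ) *m RZ2 (pi / 2)).
Proof.
rewrite SWAP_CPhase CPhase_zz cos_pi4 sin_pi4 -scalemxAr mulmxA -scalerA -mulmxA; congr (_ *: _).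
rewrite -fmorphV -mulmxA [in RHS]scalemxAr [in RHS]scalemxAl; congr (_ *m (_ *m _)).
by rewrite /zz_mx scalerDr scalerA mulrC.
Qed.

Lemma neighbours_neq n (j k : 'I_n) : neighbours j k -> j != k.
Proof. by case=> jk; rewrite -val_eqE /= jk neq_ltn ltnSn ?orbT. Qed.

Lemma CPhase_gaussian (phi : R) n (j k : 'I_n) : j != k ->
  gaussian_factors (CPhase_term phi) 1%:M (cis (phi / 4) *: RZ2 (phi / 2)) j k.
Proof.
move=> jk; split=> [e||].
- rewrite gate_at_mul_diag ?RZ2_diag //.
  by apply: gaussianM; [apply: gaussian_two_ZZ|apply: gaussian_gate_RZ].
- by rewrite gate_at1 //; apply: gaussian1.
- by rewrite gate_atZ; apply: gaussianZ; [apply: cis_conj|apply: gaussian_gate_RZ].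
Qed.

Lemma RZZ_gaussian n (j k : 'I_n) : j != k -> gaussian_factors (@RZZ_term R) 1%:M 1%:M j k.
Proof.
move=> jk; split=> [e||]; first exact: gaussian_two_ZZ.
- by rewrite gate_at1 //; apply: gaussian1.
- by rewrite gate_at1 //; apply: gaussian1.
Qed.

Lemma SWAP_gaussian n (j k : 'I_n) : neighbours j k ->
  gaussian_factors (@SWAP_term R) fSWAP (cis (pi / 4) *: RZ2 (pi / 2)) j k.
Proof.
move=> nb; have jk := neighbours_neq nb; split=> [e||].
- rewrite !gate_at_mul_diag ?RZ2_diag ?two_ZZ_diag //.
  apply: gaussianM; last exact: gaussian_gate_RZ.
  by apply: gaussianM; [apply: gaussian_fSWAP|apply: gaussian_two_ZZ].
- exact: gaussian_fSWAP.
- by rewrite gate_atZ; apply: gaussianZ; [apply: cis_conj|apply: gaussian_gate_RZ].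
Qed.

Lemma CPhase_sum (phi : R) : CPhase phi = \sum_e CPhase_coef phi e *: CPhase_term phi e.
Proof. by rewrite big_bool /= CPhase_zz zz_mx_RZ2 scalerDr !scalerA addrC. Qed.

(** The global phase goes into the right Gaussian factor, so that the middle factor is a + i b Z(x)Z
    with real a and b. *)
Lemma CPhase_prod (phi : R) : CPhase phi = 1%:M *m
  zz_mx (cos (phi / 4))%:C (ii * (sin (phi / 4))%:C) *m (cis (phi / 4) *: RZ2 (phi / 2)).
Proof. by rewrite mul1mx CPhase_zz scalemxAr. Qed.

Lemma CPhase_coef_norm (phi : R) :
  l1norm (CPhase_coef phi) = `|cos (phi / 4)| + `|sin (phi / 4)|.
Proof.
rewrite /l1norm big_bool /CPhase_coef /two !ComplexField.Normc.normcM norm_cis norm_ii.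
by rewrite !norm_real !mul1r addrC.
Qed.

Lemma RZZ_sum (phi : R) : RZZ phi = \sum_e RZZ_coef phi e *: RZZ_term e.
Proof. by rewrite big_bool /= RZZE addrC mulNr scaleNr. Qed.

Lemma RZZ_prod (phi : R) : RZZ phi = 1%:M *m
  zz_mx (cos (phi / 2))%:C (ii * (- sin (phi / 2))%:C) *m 1%:M.
Proof. by rewrite mul1mx mulmx1 RZZE /zz_mx rmorphN mulrN scaleNr. Qed.

Lemma RZZ_coef_norm (phi : R) :
  l1norm (RZZ_coef phi) = `|cos (phi / 2)| + `|- sin (phi / 2)|.
Proof.
rewrite /l1norm big_bool /RZZ_coef /two ComplexField.Normc.normcM !norm_real normrN addrC.
by rewrite [normc _](_ : _ = 1) ?mul1r // /= oppr0 expr0n add0r sqrrN expr1n sqrtr1.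
Qed.

Lemma SWAP_sum : @SWAP R = \sum_e SWAP_coef e *: SWAP_term e.
Proof.
rewrite big_bool /= SWAP_zz mulmxDr mulmxDl scalerDr addrC; congr (_ + _).
by rewrite -scalemxAr -scalemxAl scalerA.
Qed.

Lemma SWAP_prod : @SWAP R = fSWAP *m
  zz_mx (cos (pi / 4))%:C (ii * (sin (pi / 4))%:C) *m (cis (pi / 4) *: RZ2 (pi / 2)).
Proof. by rewrite SWAP_CPhase CPhase_zz -!scalemxAr mulmxA. Qed.

Lemma SWAP_coef_norm : l1norm (@SWAP_coef R) = `|cos (pi / 4)| + `|sin (pi / 4)|.
Proof.
have s2 : normc (cis (pi / 4) / (Num.sqrt 2)%:C : C) = (Num.sqrt 2)^-1.
  by rewrite ComplexField.Normc.normcM norm_cis mul1r -fmorphV norm_real ger0_norm.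
rewrite /l1norm big_bool /SWAP_coef /two ComplexField.Normc.normcM s2 norm_ii mulr1.
by rewrite cos_pi4 sin_pi4 ger0_norm // invr_ge0 sqrtr_ge0.
Qed.

Lemma CPhase_extent (phi : R) : l1norm (CPhase_coef phi) ^+ 2 = 1 + `|sin (phi / 2)|.
Proof. by rewrite CPhase_coef_norm norm_cos_sin_sq; congr (1 + `|sin _|); field. Qed.

Lemma RZZ_extent (phi : R) : l1norm (RZZ_coef phi) ^+ 2 = 1 + `|sin phi|.
Proof. by rewrite RZZ_coef_norm normrN norm_cos_sin_sq; congr (1 + `|sin _|); field. Qed.

Lemma SWAP_extent : l1norm (@SWAP_coef R) ^+ 2 = 2.
Proof.
rewrite SWAP_coef_norm norm_cos_sin_sq.
have -> : pi / 4 *+ 2 = pi / 2 :> R by field.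
by rewrite sin_pihalf normr1.
Qed.
End ConcreteGates.

Unset Implicit Arguments.

Theorem mainTheorem4 (R : realType) (theta : R)
    (htheta : 0 <= theta < 2 * pi) :
  (* (i) *)
  (CPhase theta =
     cis (theta / 4) *:
       (((cos (theta / 4))%:C *: 1%:M + (ii * (sin (theta / 4))%:C) *: ZZ)
        *m (RZ (theta / 2) *t RZ (theta / 2))) /\
   forall (n : nat) (j k : 'I_n), j != k ->
     xi (gate_at j k (CPhase theta)) = 1 + `|sin (theta / 2)| /\
     optimal (CPhase_coef theta)
       (fun e => gate_at j k (CPhase_term theta e))
       (gate_at j k (CPhase theta))) /\
  (* (ii) *)
  (RZZ theta =
     (cos (theta / 2))%:C *: 1%:M - (ii * (sin (theta / 2))%:C) *: ZZ /\
   forall (n : nat) (j k : 'I_n), j != k ->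
     xi (gate_at j k (RZZ theta)) = 1 + `|sin theta| /\
     optimal (RZZ_coef theta)
       (fun e => gate_at j k (RZZ_term e))
       (gate_at j k (RZZ theta))) /\
  (* (iii) *)
  (@SWAP R =
     (cis (pi / 4) / (Num.sqrt 2)%:C) *:
       (fSWAP *m (1%:M + ii *: ZZ) *m (RZ (pi / 2) *t RZ (pi / 2))) /\
   forall (n : nat) (j k : 'I_n), neighbours j k ->
     xi (gate_at j k (@SWAP R)) = 2 /\
     optimal SWAP_coef
       (fun e => gate_at j k (SWAP_term e))
       (gate_at j k (@SWAP R))) /\
  (* (iv) *)
  (forall (t n : nat) (p q : 'I_t -> 'I_n), disjoint_pairs p q ->
     [/\ xi (tensor_power p q (CPhase theta)) = (1 + `|sin (theta / 2)|) ^+ t,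
         optimal (tensor_coef (CPhase_coef theta))
           (tensor_term p q (CPhase_term theta))
           (tensor_power p q (CPhase theta)),
         xi (tensor_power p q (RZZ theta)) = (1 + `|sin theta|) ^+ t,
         optimal (tensor_coef (RZZ_coef theta))
           (tensor_term p q RZZ_term)
           (tensor_power p q (RZZ theta)) &
         (forall s, neighbours (p s) (q s)) ->
           xi (tensor_power p q (@SWAP R)) = 2 ^+ t /\
           optimal (tensor_coef SWAP_coef)
             (tensor_term p q SWAP_term)
             (tensor_power p q (@SWAP R))]).
Proof.
(* Right factors stay diagonal with their global phase, as splitting them off a tensor product
   requires. *)
have cl (z : R[i]) (A : 'M[R[i]]_(2 * 2)) :
  is_diag_mx A -> is_diag_mx (z *: A).
  move=> /is_diag_mxP dA; apply/is_diag_mxP => x y xy.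
  by rewrite scalemxE dA // mulr0.
have dP := cl (cis (theta / 4)) _ (RZ2_diag (theta / 2)).
have dS := cl (cis (pi / 4)) _ (RZ2_diag (pi / 2)).
have d1 : is_diag_mx (1%:M : 'M[R[i]]_(2 * 2)) by exact: scalar_mx_is_diag.
split; [|split; [|split]].
- split=> [|n j k jk]; first exact: CPhase_zz.
  rewrite -CPhase_extent; apply: (optimal_gate_at (CPhase_sum _) (CPhase_prod _) dP) => //.
    exact: CPhase_coef_norm.
  exact: CPhase_gaussian.
- split=> [|n j k jk]; first exact: RZZE.
  rewrite -RZZ_extent; apply: (optimal_gate_at (RZZ_sum _) (RZZ_prod _) d1) => //.
    exact: RZZ_coef_norm.
  exact: RZZ_gaussian.
- split=> [|n j k jk]; first exact: SWAP_zz.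
  rewrite -SWAP_extent; apply: (optimal_gate_at (SWAP_sum _) (SWAP_prod _) dS) => //.
  + exact: SWAP_coef_norm.
  + exact: neighbours_neq.
  + exact: SWAP_gaussian.
move=> t n p q dpq; have pq s : p s != q s by case: dpq.
have [xC oC] : _ /\ _ := optimal_tensor_power (CPhase_sum theta) (CPhase_prod theta) dP
  (CPhase_coef_norm theta) dpq (fun s => CPhase_gaussian theta (pq s)).
have [xR oR] : _ /\ _ := optimal_tensor_power (RZZ_sum theta) (RZZ_prod theta) d1
  (RZZ_coef_norm theta) dpq (fun s => RZZ_gaussian R (pq s)).
split=> // [||nb].
- by rewrite xC CPhase_extent.
- by rewrite xR RZZ_extent.
have [xS oS] : _ /\ _ := optimal_tensor_power (SWAP_sum R) (SWAP_prod R) dS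
  (SWAP_coef_norm R) dpq (fun s => SWAP_gaussian R (nb s)).
by split=> //; rewrite xS SWAP_extent.
Qed.
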